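(* Consider the sparse reduced rank regression model $\mathbf Y=\mathbf X\mathbf C^0+\mathbf E$ described in the context, in an asymptotic regime $n\to\infty$ in which $p,q,s,r$ may depend on $n$. Assume: (1) There is a constant $C>0$ (independent of $n$) such that $\mathrm{tr}(\mathbf M^T\boldsymbol\Sigma\mathbf M)\ge C\sum_{j=1}^{s}\|\mathbf m_j\|^2$ for every $p\times q$ matrix $\mathbf M$ with rows $\mathbf m_1,\dots,\mathbf m_p$ satisfying $\sum_{j=s+1}^{p}\|\mathbf m_j\|\le 2\sum_{j=1}^{s}\|\mathbf m_j\|$. (2) The greatest eigenvalue of $\boldsymbol\Sigma$ is bounded above by a constant independent of $n$. (3) The rows $\mathbf E_1^T,\dots,\mathbf E_n^T$ of $\mathbf E$ are independent and identically distributed with mean zero, and there is a constant $C>0$ (independent of $n$) such that $\mathbb E\exp(t\,\mathbf E_i^T\boldsymbol\eta)\le\exp(Ct^2\|\boldsymbol\eta\|^2)$ for all $t\in\mathbb R$ and all $\boldsymbol\eta\in\mathbb R^q$. (4) The penalty parameters $\lambda_j\ge 0$, $1\le j\le p$, are such that $\lambda_{(1)}=\max_{1\le j\le s}\lambda_j$ and $\lambda_{(2)}=\min_{s+1\le j\le p}\lambda_j$ satisfy $$\lambda_{(1)}\lesssim\sqrt{\frac{r(q+s-r)}{ns}},\qquad \lambda_{(2)}\gg\sqrt{\frac{q\log(p)+r(q+s-r)}{n}}.$$ Let $\widehat{\mathbf C}$ be a (global) solution of $$\min_{\mathbf C\in\mathbb R^{p\times q}:\ \mathrm{rank}(\mathbf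 C)\le r}\ \|\mathbf Y-\mathbf X\mathbf C\|^2+n\sum_{j=1}^p\lambda_j\|\mathbf C_j\|,$$ where $\mathbf C_j^T$ denotes the $j$-th row of $\mathbf C$. Then: 1. $\|\mathbf X\widehat{\mathbf C}-\mathbf X\mathbf C^0\|=O_p\big(\sqrt{r(q+s-r)}\big)$; 2. $\mathbb P(\widehat{\mathbf C}_j=\mathbf 0 \text{ for all } s+1\le j\le p)\to1$ as $n\to\infty$; 3. $\|\widehat{\mathbf C}-\mathbf C^0\|=O_p\big(\sqrt{r(q+s-r)/n}\big)$.
   Context: Model: for each $n$, $\mathbf Y=\mathbf X\mathbf C^0+\mathbf E$, where $\mathbf Y$ is the $n\times q$ response matrix, $\mathbf X$ is the $n\times p$ (non-random) design matrix, $\mathbf E$ is the $n\times q$ random error matrix with mean-zero entries, and $\mathbf C^0$ is the $p\times q$ true coefficient matrix, with $\mathrm{rank}(\mathbf C^0)\le r$, where $1\le r\le\min(p,q)$. The number of nonzero rows of $\mathbf C^0$ is $s$, with $1\le s<p$, and these are its first $s$ rows (the ''relevant predictors''); rows $s+1,\dots,p$ of $\mathbf C^0$ are zero. Notation: $\|\cdot\|$ is the Frobenius norm (Euclidean norm for vectors); $\boldsymbol\Sigma=\mathbf X^T\mathbf X/n$; for sequences in $n$, $a\ll b$ means $a=o(b)$ and $a\lesssim b$ means $a=O(b)$; $Z_n=O_p(a_n)$ means that for each $\delta>0$ there is $K<\infty$ with $\mathbb P(|Z_n|>Ka_n)\le\delta$ for all sufficiently large $n$. *)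

(* Defs.v *)
From mathcomp Require Import all_boot all_order all_algebra.
From mathcomp Require Import all_classical all_reals all_analysis.

Set Implicit Arguments.
Unset Strict Implicit.
Unset Printing Implicit Defensive.

Import Order.TTheory GRing.Theory Num.Theory.
Import numFieldNormedType.Exports.

Local Open Scope classical_set_scope.
Local Open Scope ring_scope.

(* The library norm [`|A|] on matrices is the entrywise maximum, hence this
   separate notion; on row and column vectors it is the Euclidean norm. *)
Definition frobenius (R : realType) (m n : nat) (A : 'M[R]_(m, n)) : R :=
  Num.sqrt (\sum_(i < m) \sum_(j < n) A i j ^+ 2).

Definition sample_cov (R : realType) (n p : nat) (X : 'M[R]_(n, p)) : 'M[R]_p :=
  n%:R^-1 *: (X^T *m X).

(* Indices are 0-based: the relevant predictors are the j with j < s. *)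
Definition restricted_eigenvalue (R : realType) (p q s : nat)
    (S : 'M[R]_p) (c : R) : Prop :=
  forall M : 'M[R]_(p, q),
    \sum_(j < p | (s <= j)%N) frobenius (row j M)
      <= 2 * \sum_(j < p | (j < s)%N) frobenius (row j M) ->
    c * \sum_(j < p | (j < s)%N) frobenius (row j M) ^+ 2
      <= \tr (M^T *m S *m M).

Definition srrr_objective (R : realType) (n p q : nat) (Y : 'M[R]_(n, q))
    (X : 'M[R]_(n, p)) (lam : 'I_p -> R) (C : 'M[R]_(p, q)) : R :=
  frobenius (Y - X *m C) ^+ 2
    + n%:R * \sum_(j < p) lam j * frobenius (row j C).

Definition is_srrr_solution (R : realType) (n p q r : nat) (Y : 'M[R]_(n, q))
    (X : 'M[R]_(n, p)) (lam : 'I_p -> R) (C : 'M[R]_(p, q)) : Prop :=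
  (\rank C <= r)%N /\
  forall C' : 'M[R]_(p, q), (\rank C' <= r)%N ->
    srrr_objective Y X lam C <= srrr_objective Y X lam C'.

(* The two sets below are finite, and nonempty when 0 < s < p, so that [sup]
   and [inf] are then a maximum and a minimum. *)
Definition lambda1 (R : realType) (p s : nat) (lam : 'I_p -> R) : R :=
  sup [set lam j | j in [set j : 'I_p | (j < s)%N]].

Definition lambda2 (R : realType) (p s : nat) (lam : 'I_p -> R) : R :=
  inf [set lam j | j in [set j : 'I_p | (s <= j)%N]].

Definition srrr_rate (R : realType) (q s r : nat) : R :=
  r%:R * (q%:R + s%:R - r%:R).

Definition borel_rV (R : realType) (q : nat) : set (set 'rV[R]_q) :=
  <<s [set A : set 'rV[R]_q | open A] >>.

Definition random_matrix (d : measure_display) (T : measurableType d)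
    (R : realType) (m n : nat) (A : T -> 'M[R]_(m, n)) : Prop :=
  forall i j, measurable_fun [set: T] (fun w => A w i j).

Definition independent_vectors (d : measure_display) (T : measurableType d)
    (R : realType) (P : probability T R) (n q : nat)
    (Z : 'I_n -> T -> 'rV[R]_q) : Prop :=
  forall (J : {set 'I_n}) (B : 'I_n -> set 'rV[R]_q),
    (forall i, borel_rV (B i)) ->
    P (\bigcap_(i in [set` J]) (Z i @^-1` B i))
      = (\prod_(i in J) P (Z i @^-1` B i))%E.

Definition identically_distributed (d : measure_display) (T : measurableType d)
    (R : realType) (P : probability T R) (n q : nat)
    (Z : 'I_n -> T -> 'rV[R]_q) : Prop :=
  forall (i j : 'I_n) (B : set 'rV[R]_q), borel_rV B ->
    P (Z i @^-1` B) = P (Z j @^-1` B).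

(* Each Z n may live on its own probability space. *)
Definition bigO_prob (R : realType) (d : nat -> measure_display)
    (T : forall n, measurableType (d n)) (P : forall n, probability (T n) R)
    (Z : forall n, T n -> R) (a : nat -> R) : Prop :=
  forall delta : R, 0 < delta -> exists K : R, \forall n \near \oo,
    (P n [set w | (K * a n < `|Z n w|)%R] <= delta%:E)%E.

(* Main.v *)
(* Write D = Chat - C0, a = r(q+s-r), F for the Frobenius norm of the first s
   rows of D and S for the sum of the norms of the other rows.  On an event of
   probability close to 1 the operator norm of the first s rows of X^T E is
   O(sqrt (n(s+q))), and each row of X^T E is O(sqrt (n(q log p + a))): this is
   a Chernoff bound together with a union bound over lattice nets of size 64^m.
   Since the first s rows of D have rank at most k = min(2r, s), and
   k(s+q) <= 4a, the noise term <E, XD> is at most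
     K n sqrt (a/n) F + K n sqrt ((q log p + a)/n) S.
   Comparing the objective at Chat and C0, the penalty lambda_(2) absorbs the
   term in S, so D lies in the cone of the restricted eigenvalue condition, and
   F = O(sqrt (a/n)), S <= F and |XD|^2 = O(a) follow.  Comparing Chat with the
   matrix obtained by zeroing its irrelevant rows gives
   lambda_(2) S <= O(sqrt ((q log p + a)/n) + F) S, hence S = 0. *)

Require Import Defs.
From mathcomp Require Import all_boot all_order all_algebra.
From mathcomp Require Import all_classical all_reals all_analysis.
From mathcomp Require Import finmap measurable_realfun.
From mathcomp Require Import ring lra zify.

Import Order.TTheory GRing.Theory Num.Theory.
Import numFieldNormedType.Exports.

Local Open Scope classical_set_scope.
Local Open Scope ring_scope.

Set Implicit Arguments.
Unset Strict Implicit.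
Unset Printing Implicit Defensive.

(** * Exponential moments of bilinear forms in a matrix with independent rows *)

Section independent_products.
Import HBNNSimple.
Context d (T : measurableType d) (R : realType) (P : probability T R).
Variables (n : nat) (V : 'I_n -> T -> R).
Hypothesis mV : forall i, measurable_fun [set: T] (V i).
Hypothesis indepV : forall B : 'I_n -> set R, (forall i, measurable (B i)) ->
  P (\bigcap_i (V i @^-1` B i)) = (\prod_i P (V i @^-1` B i))%E.

Local Lemma measurable_preimageV i B : measurable B -> measurable (V i @^-1` B).
Proof. by move=> mB; rewrite -[X in measurable X]setTI; exact: mV. Qed.

Lemma integral_sum_indic (I : finType) (y : I -> R) (A : I -> set T) :
  (forall k, 0 <= y k) -> (forall k, measurable (A k)) ->
  (\int[P]_w (\sum_k y k * \1_(A k) w)%:E = (\sum_k y k * fine (P (A k)))%:E)%E.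
Proof.
move=> y0 mA.
under eq_integral do rewrite -sumEFin.
rewrite ge0_integral_sum//=; last 2 first.
- move=> k; apply/measurable_EFinP; apply: measurable_funM => //.
- by move=> k x _; rewrite lee_fin mulr_ge0.
rewrite -sumEFin; apply: eq_bigr => k _.
under eq_integral do rewrite EFinM.
rewrite ge0_integralZl_EFin//; last exact/measurable_EFinP.
by rewrite integral_indic// setIT EFinM fineK// fin_num_measure.
Qed.

(** Each [g (V i w)] is a finite sum over the values of [g], so the product expands into a sum over
    all maps [f] from indices to values. Independence factors the probability of each intersection,
    and the sum folds back into a product of integrals. *)
Local Lemma integral_prod_simple (g : {nnsfun R >-> R}) :
  (\int[P]_w (\prod_i g (V i w))%:E = \prod_i \int[P]_w (g (V i w))%:E)%E.
Proof.
pose s := fset_set (g @` setT).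
pose y (k : 'I_#|`s|) := nth 0 s k.
pose A k := g @^-1` [set y k].
have gE x : g x = \sum_k y k * \1_(A k) x by rewrite {1}fimfunEord.
have mA k : measurable (A k) by exact: measurable_sfunP.
have y0 k : 0 <= y k.
  have /= : nth 0 s k \in s by rewrite mem_nth.
  by rewrite in_fset_set// => /set_mem[x _ yx]; rewrite /y -yx.
have mVA i k : measurable (V i @^-1` A k) by exact: measurable_preimageV.
have -> : (\int[P]_w (\prod_i g (V i w))%:E)%E =
    (\sum_(f : {ffun 'I_n -> 'I_#|`s|})
       (\prod_i y (f i)) * fine (P (\bigcap_i (V i @^-1` A (f i)))))%:E.
  rewrite -integral_sum_indic.
  - apply: eq_integral => w _; congr EFin.
    under eq_bigr do rewrite gE.
    rewrite bigA_distr_bigA/=; apply: eq_bigr => f _.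
    rewrite big_split/=; congr (_ * _).
    have [wA|wA] := pselect ((\bigcap_i (V i @^-1` A (f i))) w).
      rewrite indicE mem_set// big1// => i _.
      by rewrite indicE mem_set//; exact: wA.
    rewrite indicE memNset//; apply/eqP; rewrite prodf_seq_eq0.
    move/existsNP: wA => -[i /not_implyP[_ wi]].
    by apply/hasP; exists i; rewrite ?mem_index_enum//= indicE memNset.
  - by move=> f; apply: prodr_ge0.
  - by move=> f; apply: fin_bigcap_measurable.
have gi i : (\int[P]_w (g (V i w))%:E)%E =
    (\sum_k y k * fine (P (V i @^-1` A k)))%:E.
  rewrite -integral_sum_indic//; apply: eq_integral => w _.
  by rewrite gE.
under [RHS]eq_bigr do rewrite gi.
rewrite prodEFin; congr EFin; rewrite bigA_distr_bigA/=.
apply: eq_bigr => f _; rewrite big_split/=; congr (_ * _).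
rewrite indepV// -[RHS]/(fine (_%:E)) -prodEFin.
congr fine; apply: eq_bigr => i _.
by rewrite fineK// fin_num_measure.
Qed.

(** The upper half of the product rule, which is what a Chernoff bound uses. Only the left side is
    taken to the limit; the factors on the right are compared through [g m <= f]. *)
Lemma integral_prod_le (f : R -> R) : measurable_fun [set: R] f ->
    (forall x, 0 <= f x) ->
  (\int[P]_w (\prod_i f (V i w))%:E <= \prod_i \int[P]_w (f (V i w))%:E)%E.
Proof.
move=> mf f0.
have mEf : measurable_fun [set: R] (EFin \o f) by exact/measurable_EFinP.
(* Expand products of simple approximations, then use monotone convergence. *)
pose g := nnsfun_approx measurableT mEf.
have gcvg x : g ^~ x @ \oo --> f x.
  have /fine_cvgP[_ //] : (EFin \o g ^~ x) @ \oo --> (f x)%:E.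
  by apply: cvg_nnsfun_approx => // y _; rewrite lee_fin.
have gnd x : nondecreasing_seq (g ^~ x).
  by move=> m k mk; exact: (lefP _ _ (nd_nnsfun_approx measurableT mEf mk)).
have gf m x : g m x <= f x.
  rewrite -(cvg_lim _ (gcvg x))//; apply: nondecreasing_cvgn_le => //.
  by apply/cvg_ex; exists (f x).
have mgV m i : measurable_fun [set: T] (fun w => g m (V i w)).
  exact: measurableT_comp.
have mprod m : measurable_fun [set: T] (fun w => (\prod_i g m (V i w))%:E).
  by apply/measurable_EFinP; apply: measurable_prod.
have intcvg : (\int[P]_w (\prod_i g m (V i w))%:E)%E @[m --> \oo] -->
    (\int[P]_w (\prod_i f (V i w))%:E)%E.
  have -> : (\int[P]_w (\prod_i f (V i w))%:E =
      \int[P]_w (limn (fun m => (\prod_i g m (V i w))%:E)))%E.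
    apply: eq_integral => w _; apply/esym/cvg_lim => //.
    apply: cvg_EFin; first by apply: nearW.
    elim: (index_enum _) => [|i e IH].
      by under eq_fun do rewrite big_nil; rewrite big_nil; exact: cvg_cst.
    under eq_fun do rewrite big_cons; rewrite big_cons; exact: cvgM.
  apply: cvg_monotone_convergence => //.
  - by move=> m w _; rewrite lee_fin prodr_ge0.
  - move=> w _ m k mk; rewrite lee_fin ler_prod// => i _.
    by rewrite gnd// andbT.
rewrite -(cvg_lim _ intcvg)//; apply: lime_le.
  by apply/cvg_ex; eexists; exact: intcvg.
apply: nearW => m; rewrite integral_prod_simple.
(* Multiplying inequalities between extended reals requires nonnegative left factors, so the
   induction carries nonnegativity along. *)
pose prod_le (x y : \bar R) := (0 <= x)%E /\ (x <= y)%E.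
suff [] : prod_le (\prod_i \int[P]_w (g m (V i w))%:E)%E
    (\prod_i \int[P]_w (f (V i w))%:E)%E by [].
elim/big_rec2: _ => [|i y1 y2 _ [y10 y12]]; first by split; rewrite ?lee01.
have ig0 : (0 <= \int[P]_w (g m (V i w))%:E)%E.
  by apply: integral_ge0 => w _; rewrite lee_fin.
split; first exact: mule_ge0.
apply: lee_pmul => //; apply: ge0_le_integral => //.
- by move=> w _; rewrite lee_fin.
- exact/measurable_EFinP.
- by apply/measurable_EFinP; exact: measurableT_comp.
- by move=> w _; rewrite lee_fin.
Qed.

End independent_products.

Lemma continuous_sum (R : realType) (U : topologicalType) (I : Type)
    (e : seq I) (F : I -> U -> R) :
  (forall i, continuous (F i)) -> continuous (fun z => \sum_(i <- e) F i z).
Proof.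
move=> Fcts; elim: e => [|i e IH].
  rewrite (_ : (fun _ => _) = cst 0); first exact: cst_continuous.
  by apply/funext => z; rewrite big_nil.
rewrite (_ : (fun _ => _) = (fun z => F i z + \sum_(j <- e) F j z)).
  by move=> z; apply: cvgD; [exact: Fcts|exact: IH].
by apply/funext => z; rewrite big_cons.
Qed.

(** Transfers independence from row vectors to their products with [eta]. A linear form is
    continuous, and it suffices to test open intervals, which generate the Borel sets of the
    line. *)
Lemma borel_rV_linear_preimage (R : realType) q (eta : 'cV[R]_q) (B : set R) :
  measurable B -> borel_rV [set z : 'rV[R]_q | B ((z *m eta) ord0 ord0)].
Proof.
pose f (z : 'rV[R]_q) : R := (z *m eta) ord0 ord0.
have fcts : continuous f.
  have -> : f = (fun z => \sum_j z ord0 j * eta j ord0).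
    by apply/funext => z; rewrite /f mxE.
  apply: continuous_sum => j z.
  exact: (cvgMr_tmp (@coord_continuous R 1 q ord0 j z)).
pose rVborel := g_sigma_algebraType [set A : set 'rV[R]_q | open A].
suff mf : measurable_fun [set: rVborel] (f : rVborel -> R).
  by move=> mB; have := mf measurableT _ mB; rewrite setTI.
apply: (measurability _ (RGenOpens.measurableE R)).
move=> _ [_ [x [y ->]] <-]; rewrite setTI; apply: sub_sigma_algebra.
by move/continuousP: fcts; apply; exact: itv_open.
Qed.

Lemma independent_linear d (T : measurableType d) (R : realType)
    (P : probability T R) n q (E : T -> 'M[R]_(n, q)) (eta : 'cV[R]_q) :
  independent_vectors P (fun i w => row i (E w)) ->
  forall B : 'I_n -> set R, (forall i, measurable (B i)) ->
  P (\bigcap_i ((fun w => (row i (E w) *m eta) ord0 ord0) @^-1` B i)) =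
  (\prod_i P ((fun w => (row i (E w) *m eta) ord0 ord0) @^-1` B i))%E.
Proof.
move=> indep B mB.
have := indep [set: 'I_n]%SET
  (fun i => [set z : 'rV[R]_q | B i ((z *m eta) ord0 ord0)])
  (fun i => borel_rV_linear_preimage eta (mB i)).
rewrite (_ : [set` _] = setT); last by apply/seteqP; split => // i _ /=; rewrite inE.
by under eq_bigl do rewrite inE.
Qed.

Lemma measurable_row_mul d (T : measurableType d) (R : realType) n q
    (E : T -> 'M[R]_(n, q)) (eta : 'cV[R]_q) (i : 'I_n) :
  random_matrix E ->
  measurable_fun [set: T] (fun w => (row i (E w) *m eta) ord0 ord0).
Proof.
move=> mE.
rewrite (_ : (fun w => _) = (fun w => \sum_j E w i j * eta j ord0)); last first.
  by apply/funext => w; rewrite mxE; apply: eq_bigr => j _; rewrite mxE.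
apply: measurable_sum => j; apply: measurable_funM => //; exact: mE.
Qed.

(** * Chernoff bound for a bilinear form in the noise matrix *)

Section bilinear_tail.
Context d (T : measurableType d) (R : realType) (P : probability T R).
Variables (n q : nat) (E : T -> 'M[R]_(n, q)) (c : R).
Hypothesis c0 : 0 < c.
Hypothesis mE : random_matrix E.
Hypothesis indepE : independent_vectors P (fun i w => row i (E w)).
Hypothesis subgE : forall (i : 'I_n) (t : R) (eta : 'cV[R]_q),
  ('E_P[fun w => (expR (t * (row i (E w) *m eta) ord0 ord0))%R]
     <= (expR (c * t ^+ 2 * frobenius eta ^+ 2))%R%:E)%E.
Variables (a : 'rV[R]_n) (eta : 'cV[R]_q).

Lemma bilinear_rowE w :
  (a *m E w *m eta) ord0 ord0 = \sum_i a ord0 i * (row i (E w) *m eta) ord0 ord0.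
Proof.
rewrite -mulmxA mxE; apply: eq_bigr => i _; congr (_ * _).
by rewrite -row_mul [RHS]mxE.
Qed.

Lemma measurable_bilinear :
  measurable_fun [set: T] (fun w => (a *m E w *m eta) ord0 ord0).
Proof.
under eq_fun do rewrite bilinear_rowE.
apply: measurable_sum => i; apply: measurable_funM => //.
exact: measurable_row_mul.
Qed.

Lemma frobenius_sq m k (A : 'M[R]_(m, k)) :
  frobenius A ^+ 2 = \sum_i \sum_j A i j ^+ 2.
Proof. by rewrite sqr_sqrtr// sumr_ge0// => i _; rewrite sumr_ge0// => j _; rewrite sqr_ge0. Qed.

(** The form is a sum over independent rows, so its exponential is a product. The sub-Gaussian bound
    is applied to row [i] at the parameter [t * a_i], and the exponents add up to [|a|^2]. *)
Lemma bilinear_mgf (t : R) :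
  (\int[P]_w (expR (t * (a *m E w *m eta) ord0 ord0))%:E <=
   (expR (c * t ^+ 2 * (frobenius a ^+ 2 * frobenius eta ^+ 2)))%:E)%E.
Proof.
pose V i w := t * a ord0 i * (row i (E w) *m eta) ord0 ord0.
have mV i : measurable_fun [set: T] (V i).
  by apply: measurable_funM => //; exact: measurable_row_mul.
have indepV (B : 'I_n -> set R) : (forall i, measurable (B i)) ->
    P (\bigcap_i (V i @^-1` B i)) = (\prod_i P (V i @^-1` B i))%E.
  move=> mB; apply: (@independent_linear _ _ _ _ _ _ _ eta indepE
    (fun i => (fun x => t * a ord0 i * x) @^-1` B i)) => i.
  rewrite -[X in measurable X]setTI; apply: measurable_funM => //.
have -> : (\int[P]_w (expR (t * (a *m E w *m eta) ord0 ord0))%:E =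
    \int[P]_w (\prod_i expR (V i w))%:E)%E.
  apply: eq_integral => w _; congr EFin.
  rewrite -expR_sum; congr expR; rewrite bilinear_rowE mulr_sumr.
  by apply: eq_bigr => i _; rewrite mulrA.
apply: le_trans.
  exact: (integral_prod_le mV indepV (@measurable_expR R) (@expR_ge0 R)).
have -> : expR (c * t ^+ 2 * (frobenius a ^+ 2 * frobenius eta ^+ 2)) =
    \prod_i expR (c * (t * a ord0 i) ^+ 2 * frobenius eta ^+ 2).
  rewrite -expR_sum; congr expR; rewrite [in LHS]frobenius_sq.
  rewrite big_ord1 mulr_suml mulr_sumr; apply: eq_bigr => i _.
  by rewrite exprMn; ring.
rewrite -prodEFin.
pose prod_le (x y : \bar R) := (0 <= x)%E /\ (x <= y)%E.
suff [] : prod_le (\prod_i \int[P]_w (expR (V i w))%:E)%E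
    (\prod_i (expR (c * (t * a ord0 i) ^+ 2 * frobenius eta ^+ 2))%:E)%E by [].
elim/big_rec2: _ => [|i y1 y2 _ [y10 y12]]; first by split; rewrite ?lee01.
have ig0 : (0 <= \int[P]_w (expR (V i w))%:E)%E.
  by apply: integral_ge0 => w _; rewrite lee_fin expR_ge0.
split; first exact: mule_ge0.
apply: lee_pmul => //.
by have := subgE i (t * a ord0 i) eta; rewrite unlock.
Qed.

(** Stated with a positive majorant [B] of the product of squared norms, because that product may
    vanish, for instance at the zero net point. *)
Lemma bilinear_tail (B t : R) : 0 < B -> 0 <= t ->
  frobenius a ^+ 2 * frobenius eta ^+ 2 <= B ->
  (P [set w | (t < (a *m E w *m eta) ord0 ord0)%R] <=
   (expR (- (t ^+ 2 / (4 * c * B))))%:E)%E.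
Proof.
move=> B0 t0 aB.
(* The minimiser of the Chernoff exponent [- l t + c l^2 B]. *)
pose l := t / (2 * c * B).
have l0 : 0 <= l by rewrite divr_ge0// !mulr_ge0// ltW.
pose f w := expR (- (l * t)) * expR (l * (a *m E w *m eta) ord0 ord0).
have mf : measurable_fun [set: T] f.
  apply: measurable_funM => //; apply: measurableT_comp => //.
  by apply: measurable_funM => //; exact: measurable_bilinear.
have mA : measurable [set w | t < (a *m E w *m eta) ord0 ord0].
  rewrite -[X in measurable X]setTI.
  rewrite (_ : [set w | _] = (fun w => (a *m E w *m eta) ord0 ord0) @^-1` `]t, +oo[%classic).
    exact: measurable_bilinear.
  by apply/seteqP; split => w /=; rewrite in_itv/= andbT.
rewrite -[X in P X]setIT -(integral_indic _ measurableT mA).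
apply: (@le_trans _ _ (\int[P]_w (f w)%:E)%E).
  apply: ge0_le_integral => //.
  - exact/measurable_EFinP.
  - exact/measurable_EFinP.
  - move=> w _; rewrite lee_fin /f -expRD indicE.
    have [tw|_] := boolP (w \in _); last exact: expR_ge0.
    rewrite -[leLHS]expR0 ler_expR -mulrN -mulrDr mulr_ge0// addrC subr_ge0.
    by move/set_mem : tw => /= /ltW.
under eq_integral do rewrite EFinM.
rewrite ge0_integralZl_EFin ?expR_ge0//=; last first.
  apply/measurable_EFinP; apply: measurableT_comp => //.
  by apply: measurable_funM => //; exact: measurable_bilinear.
apply: (le_trans (lee_wpmul2l _ (bilinear_mgf l))); first by rewrite lee_fin expR_ge0.
rewrite -EFinM lee_fin -expRD ler_expR.
have mgf_le : c * l ^+ 2 * (frobenius a ^+ 2 * frobenius eta ^+ 2) <= c * l ^+ 2 * B.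
  by rewrite ler_wpM2l// mulr_ge0 ?sqr_ge0// ltW.
have -> : - (t ^+ 2 / (4 * c * B)) = - (l * t) + c * l ^+ 2 * B.
  by rewrite /l; field; rewrite !gt_eqF.
by rewrite lerD2l.
Qed.

End bilinear_tail.

(** * A lattice net for the Euclidean ball *)

Section lattice_net.
Variables (R : realType) (m : nat).

(** A magnitude and a sign bit per coordinate, which makes the index type finite. The cap [4 m]
    loses no net point, since no magnitude exceeds its square. Zero is represented twice, which only
    enlarges the count. *)
Definition lattice_index := {ffun 'I_m -> 'I_(4 * m).+1 * bool}.

Definition lattice_point (f : lattice_index) : 'cV[R]_m :=
  \col_k ((-1) ^+ (f k).2 * (f k).1%:R).

(** Integer points of the ball of radius [2 sqrt m], to be compared with the unit ball scaled by
    [sqrt m]. *)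
Definition in_net (f : lattice_index) := (\sum_k (f k).1 ^ 2 <= 4 * m)%N.

Lemma sqr_frobenius_lattice_point f :
  in_net f -> frobenius (lattice_point f) ^+ 2 <= 4 * m%:R.
Proof.
rewrite /in_net -(ler_nat R) natrM natr_sum frobenius_sq; apply: le_trans.
rewrite le_eqVlt; apply/orP; left; apply/eqP; apply: eq_bigr => k _.
by rewrite big_ord1 mxE exprMn -exprM mulnC exprM sqrrN !expr1n mul1r natrX.
Qed.

Lemma sum_half_pow N : \sum_(k < N) (2^-1 : R) ^+ k <= 2.
Proof.
have -> : \sum_(k < N) (2^-1 : R) ^+ k = 2 - 2 * 2^-1 ^+ N.
  elim: N => [|N IH]; first by rewrite big_ord0 expr0 mulr1 subrr.
  by rewrite big_ord_recr /= IH exprS; field.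
by rewrite gerBl mulr_ge0// exprn_ge0// invr_ge0.
Qed.

(* Each net point has weight [prod_k 16 * 2^-|z_k| >= 1], because
   [sum |z_k| <= sum z_k^2 <= 4m]; the weights sum to at most [(16 * 4)^m]. *)
Lemma card_in_net : #|in_net|%:R <= 64 ^+ m :> R.
Proof.
rewrite -sum1_card natr_sum.
pose wt (f : lattice_index) : R := \prod_k (16 * 2^-1 ^+ (f k).1).
have wt0 f : 0 <= wt f by apply: prodr_ge0 => k _; rewrite mulr_ge0// exprn_ge0// invr_ge0.
apply: (@le_trans _ _ (\sum_f wt f)).
  rewrite [leRHS](bigID in_net)/= ler_wpDr ?sumr_ge0//.
  apply: ler_sum => f netf; rewrite /wt big_split/= prodr_const card_ord.
  rewrite prodrXr.
  have lef : (\sum_k (f k).1 <= 4 * m)%N.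
    apply: leq_trans netf; apply: leq_sum => k _.
    by case: (nat_of_ord _) => // x; rewrite expnS expn1 leq_pmulr.
  have -> : (16 : R) = 2 ^+ 4 by ring.
  by rewrite -exprM exprVn ler_pdivlMr ?exprn_gt0// mul1r ler_weXn2l// ler1n.
rewrite /wt -(bigA_distr_bigA (fun (_ : 'I_m) x => 16 * 2^-1 ^+ (nat_of_ord x.1)))/=.
rewrite -[leRHS](_ : \prod_(k < m) 64 = _); last by rewrite prodr_const card_ord.
apply: ler_prod => k _; apply/andP; split.
  by apply: sumr_ge0 => x _; rewrite mulr_ge0// exprn_ge0// invr_ge0.
rewrite -mulr_sumr (_ : 64 = 16 * 4 :> R); last by ring.
rewrite ler_wpM2l//.
rewrite -(pair_big xpredT xpredT (fun k (_ : bool) => 2^-1 ^+ nat_of_ord k))/=.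
rewrite (_ : 4 = 2 * 2 :> R); last by ring.
under eq_bigr do rewrite big_bool/= -mulr2n.
by rewrite sumrMnl -[leLHS]mulr_natl ler_wpM2l// sum_half_pow.
Qed.

(** Coordinates of [w = sqrt m * v] are rounded so that no term of the product with [a] decreases. A
    magnitude grows by at most 1, so the new squared norm is at most [2 |w|^2 + 2 m <= 4 m], as the
    net allows. *)
Lemma round_to_net (a : 'rV[R]_m) (v : 'cV[R]_m) : frobenius v <= 1 ->
  exists2 f, in_net f &
    Num.sqrt m%:R * (a *m v) ord0 ord0 <= (a *m lattice_point f) ord0 ord0.
Proof.
move=> v1.
pose w k := Num.sqrt m%:R * v k ord0.
have sumw : \sum_k w k ^+ 2 <= m%:R.
  under eq_bigr do rewrite exprMn sqr_sqrtr//.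
  rewrite -mulr_sumr ler_piMr//.
  have -> : \sum_k v k ord0 ^+ 2 = frobenius v ^+ 2.
    by rewrite frobenius_sq; apply: eq_bigr => k _; rewrite big_ord1.
  by rewrite expr_le1// sqrtr_ge0.
(* Rounding up where [a] and [w] agree in sign, down elsewhere. *)
pose x k := (Num.trunc `|w k| + (0 < a ord0 k * w k)%R)%N.
have xw k : (x k)%:R <= `|w k| + 1.
  rewrite natrD lerD//; first by rewrite truncn_le.
  by case: (_ < _) => //=.
have sumx : (\sum_k x k ^ 2 <= 4 * m)%N.
  rewrite -(ler_nat R) natr_sum natrM.
  apply: (@le_trans _ _ (\sum_k (2 * w k ^+ 2 + 2))).
    apply: ler_sum => k _; rewrite natrX.
    apply: (@le_trans _ _ ((`|w k| + 1) ^+ 2)).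
      by rewrite ler_pXn2r// ?nnegrE// addr_ge0.
    rewrite -[w k ^+ 2]real_normK ?num_real//.
    by have := sqr_ge0 (`|w k| - 1); nra.
  rewrite big_split/= sumr_const card_ord -mulr_sumr -mulr_natr; nra.
have xlt k : (x k < (4 * m).+1)%N.
  rewrite ltnS; apply: leq_trans sumx; rewrite (bigD1 k)//=.
  by case: (x k) => // y; rewrite (leq_trans _ (leq_addr _ _))// expnS expn1 leq_pmulr.
exists [ffun k => (Ordinal (xlt k), w k < 0)].
  by rewrite /in_net; under eq_bigr do rewrite ffunE.
rewrite !mxE mulr_sumr; apply: ler_sum => k _; rewrite mxE ffunE/=.
have -> : Num.sqrt m%:R * (a ord0 k * v k ord0) = a ord0 k * w k.
  by rewrite /w mulrCA.
have wE : w k = (-1) ^+ (w k < 0)%R * `|w k| by rewrite {1}[w k]numEsign.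
set sg := (-1) ^+ _ in wE *; rewrite [leLHS](_ : _ = a ord0 k * sg * `|w k|); last first.
  by rewrite -mulrA -wE.
have trge : `|w k| <= (Num.trunc `|w k|)%:R + 1 by rewrite ltW// natr1 truncnS_gt.
have trle : (Num.trunc `|w k|)%:R <= `|w k| by rewrite truncn_le.
have w0 := normr_ge0 (w k).
rewrite mulrA /x; have awE : a ord0 k * w k = a ord0 k * sg * `|w k| by rewrite -mulrA -wE.
have [aw|aw] := ltP 0 (a ord0 k * w k).
  rewrite natrD ler_wpM2l// leNgt; apply/negP => asg.
  by move: aw; rewrite awE ltNge mulr_le0_ge0// ltW.
rewrite addn0; have [wk0|wk0] := eqVneq `|w k| 0.
  by rewrite wk0 truncn0.
rewrite ler_wnM2l// leNgt; apply/negP => asg.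
by move: aw; rewrite awE leNgt mulr_gt0// lt_def wk0.
Qed.
End lattice_net.

Lemma frobenius_ge0 (R : realType) m n (A : 'M[R]_(m, n)) : 0 <= frobenius A.
Proof. exact: sqrtr_ge0. Qed.

Lemma frobeniusZ (R : realType) m n (k : R) (A : 'M[R]_(m, n)) :
  frobenius (k *: A) = `|k| * frobenius A.
Proof.
apply/eqP; rewrite -(eqrXn2 (n := 2))// ?mulr_ge0 ?frobenius_ge0//.
rewrite exprMn !frobenius_sq real_normK ?num_real// mulr_sumr; apply/eqP.
apply: eq_bigr => i _; rewrite mulr_sumr; apply: eq_bigr => j _.
by rewrite mxE exprMn.
Qed.

Lemma frobenius_eq0 (R : realType) m n (A : 'M[R]_(m, n)) :
  (frobenius A == 0) = (A == 0).
Proof.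
apply/idP/eqP => [|->]; last first.
  rewrite -sqrf_eq0 frobenius_sq big1// => i _; rewrite big1// => j _.
  by rewrite mxE expr0n.
rewrite -sqrf_eq0 frobenius_sq psumr_eq0; last first.
  by move=> i _; apply: sumr_ge0 => j _; exact: sqr_ge0.
move=> /allP A0; apply/matrixP => i j; rewrite mxE; apply/eqP; rewrite -sqrf_eq0.
have := A0 i (mem_index_enum _); rewrite psumr_eq0/= => [/allP/(_ j)|k _]; last exact: sqr_ge0.
by apply; exact: mem_index_enum.
Qed.

(** Rounding never lowers the product with [a], so normalising [v] and passing to the net costs no
    constant beyond the scale [sqrt m]. *)
Lemma net_bound (R : realType) m (a : 'rV[R]_m) (t : R) :
  (forall f, in_net f -> (a *m lattice_point R f) ord0 ord0 <= t * Num.sqrt m%:R) ->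
  forall v : 'cV_m, (a *m v) ord0 ord0 <= t * frobenius v.
Proof.
move=> anet v; have [->|v0] := eqVneq v 0.
  rewrite mulmx0 mxE (_ : frobenius 0 = 0) ?mulr0//.
  by apply/eqP; rewrite frobenius_eq0.
have fv0 : 0 < frobenius v by rewrite lt_def frobenius_ge0 frobenius_eq0 v0.
have m0 : 0 < Num.sqrt m%:R :> R.
  rewrite sqrtr_gt0 ltr0n lt0n; apply: contraNneq v0 => m0.
  by apply/eqP/matrixP => i; move: (ltn_ord i); rewrite [X in (_ < X)%N]m0.
have [|f netf] := round_to_net a (v := (frobenius v)^-1 *: v).
  by rewrite frobeniusZ ger0_norm ?invr_ge0 ?frobenius_ge0// mulVf// gt_eqF.
move=> /le_trans/(_ (anet f netf)).
rewrite -scalemxAr mxE [leRHS]mulrC ler_pM2l// ler_pdivrMl//.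
by rewrite mulrC.
Qed.

(** The linear bound is applied once in each argument, with a transposition in between. *)
Lemma bilinear_net_bound (R : realType) m n (G : 'M[R]_(m, n)) (t : R) :
  (forall f g, in_net f -> in_net g ->
     ((lattice_point R f)^T *m G *m lattice_point R g) ord0 ord0
       <= t * (Num.sqrt m%:R * Num.sqrt n%:R)) ->
  forall (u : 'cV_m) (v : 'cV_n), (u^T *m G *m v) ord0 ord0 <= t * (frobenius u * frobenius v).
Proof.
have tr11 (M : 'M[R]_1) : M ord0 ord0 = M^T ord0 ord0 by rewrite mxE.
move=> Gnet u v; rewrite mulrA; apply: net_bound => g netg.
rewrite tr11 !trmx_mul trmxK mulmxA -mulrA [_ * Num.sqrt _]mulrC mulrA.
apply: net_bound => f netf; rewrite tr11 !trmx_mul !trmxK mulmxA -mulrA.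
by rewrite [Num.sqrt _ * _]mulrC; exact: Gnet.
Qed.

(** * Rank, operator norm and eigenvalues *)

Section matrix_inner_product.
Variable R : realType.

Definition mxdot m n (A B : 'M[R]_(m, n)) : R := \tr (A^T *m B).

Lemma mxdotE m n (A B : 'M[R]_(m, n)) : mxdot A B = \sum_i \sum_j A i j * B i j.
Proof.
rewrite /mxdot /mxtrace exchange_big/=; apply: eq_bigr => j _.
by rewrite mxE; apply: eq_bigr => i _; rewrite mxE.
Qed.

Lemma mxdotC m n (A B : 'M[R]_(m, n)) : mxdot A B = mxdot B A.
Proof.
by rewrite !mxdotE; apply: eq_bigr => i _; apply: eq_bigr => j _; rewrite mulrC.
Qed.

Lemma mxdotDr m n (A B C : 'M[R]_(m, n)) : mxdot A (B + C) = mxdot A B + mxdot A C.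
Proof. by rewrite /mxdot mulmxDr mxtraceD. Qed.

Lemma mxdotDl m n (A B C : 'M[R]_(m, n)) : mxdot (A + B) C = mxdot A C + mxdot B C.
Proof. by rewrite ![mxdot _ C]mxdotC mxdotDr. Qed.

Lemma mxdotZr m n k (A B : 'M[R]_(m, n)) : mxdot A (k *: B) = k * mxdot A B.
Proof. by rewrite /mxdot -scalemxAr mxtraceZ. Qed.

Lemma mxdotZl m n k (A B : 'M[R]_(m, n)) : mxdot (k *: A) B = k * mxdot A B.
Proof. by rewrite mxdotC mxdotZr mxdotC. Qed.

Lemma mxdotNr m n (A B : 'M[R]_(m, n)) : mxdot A (- B) = - mxdot A B.
Proof. by rewrite -scaleN1r mxdotZr mulN1r. Qed.

Lemma mxdotxx m n (A : 'M[R]_(m, n)) : mxdot A A = frobenius A ^+ 2.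
Proof. by rewrite mxdotE frobenius_sq. Qed.

Lemma sqr_frobeniusD m n (A B : 'M[R]_(m, n)) :
  frobenius (A + B) ^+ 2 = frobenius A ^+ 2 + 2 * mxdot A B + frobenius B ^+ 2.
Proof. by rewrite -!mxdotxx mxdotDr !mxdotDl [mxdot B A]mxdotC; ring. Qed.

Lemma mxdot_mull m n k (A : 'M[R]_(m, n)) (B : 'M[R]_(n, k)) (C : 'M[R]_(m, k)) :
  mxdot C (A *m B) = mxdot (A^T *m C) B.
Proof. by rewrite /mxdot trmx_mul trmxK mulmxA. Qed.

Lemma mxdot_mulr m n k (A : 'M[R]_(m, n)) (B : 'M[R]_(n, k)) (C : 'M[R]_(m, k)) :
  mxdot C (A *m B) = mxdot (C *m B^T) A.
Proof. by rewrite /mxdot trmx_mul trmxK mulmxA mxtrace_mulC mulmxA. Qed.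

Lemma frobeniusN m n (A : 'M[R]_(m, n)) : frobenius (- A) = frobenius A.
Proof. by rewrite -scaleN1r frobeniusZ normrN1 mul1r. Qed.

(** Cauchy-Schwarz, by expanding the square of [|B| A - |A| B]. *)
Lemma mxdot_le m n (A B : 'M[R]_(m, n)) : mxdot A B <= frobenius A * frobenius B.
Proof.
have [->|A0] := eqVneq A 0.
  by rewrite /mxdot trmx0 mul0mx mxtrace0 mulr_ge0// frobenius_ge0.
have [->|B0] := eqVneq B 0.
  by rewrite /mxdot mulmx0 mxtrace0 mulr_ge0// frobenius_ge0.
have fA : 0 < frobenius A by rewrite lt_def frobenius_ge0 frobenius_eq0 A0.
have fB : 0 < frobenius B by rewrite lt_def frobenius_ge0 frobenius_eq0 B0.
have := sqr_ge0 (frobenius (frobenius B *: A + (- frobenius A) *: B)).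
rewrite sqr_frobeniusD !frobeniusZ mxdotZl mxdotZr normrN !ger0_norm ?frobenius_ge0//.
rewrite (_ : _ + _ + _ = 2 * (frobenius A * frobenius B) *
   (frobenius A * frobenius B - mxdot A B)); last by ring.
by rewrite pmulr_rge0 ?subr_ge0// !mulr_gt0.
Qed.

Lemma sqr_frobenius_cols m n (A : 'M[R]_(m, n)) :
  frobenius A ^+ 2 = \sum_j frobenius (col j A) ^+ 2.
Proof.
rewrite frobenius_sq exchange_big/=; apply: eq_bigr => j _.
rewrite frobenius_sq; apply: eq_bigr => i _.
by rewrite big_ord1 mxE.
Qed.

Lemma sqr_frobenius_rows m n (A : 'M[R]_(m, n)) :
  frobenius A ^+ 2 = \sum_i frobenius (row i A) ^+ 2.
Proof.
rewrite frobenius_sq; apply: eq_bigr => i _.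
by rewrite frobenius_sq big_ord1; apply: eq_bigr => j _; rewrite mxE.
Qed.

(** The operator norm bound is given as a bound on a bilinear form. Testing it at [u = M v] controls
    [|M v|], and the columns of [D] are then treated one by one. *)
Lemma frobenius_mulmx_le m n k (M : 'M[R]_(m, n)) (D : 'M[R]_(n, k)) (t : R) :
  0 <= t ->
  (forall (u : 'cV_m) (v : 'cV_n),
     (u^T *m M *m v) ord0 ord0 <= t * (frobenius u * frobenius v)) ->
  frobenius (M *m D) <= t * frobenius D.
Proof.
move=> t0 Mt.
have Mv (v : 'cV_n) : frobenius (M *m v) <= t * frobenius v.
  have [->|Mv0] := eqVneq (M *m v) 0.
    have -> : frobenius (0 : 'M[R]_(m, 1)) = 0 by apply/eqP; rewrite frobenius_eq0.
    by rewrite mulr_ge0// frobenius_ge0.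
  have fMv : 0 < frobenius (M *m v) by rewrite lt_def frobenius_ge0 frobenius_eq0 Mv0.
  have := Mt (M *m v) v; rewrite -mulmxA -[X in X <= _]/(((M *m v)^T *m (M *m v)) ord0 ord0).
  have -> : ((M *m v)^T *m (M *m v)) ord0 ord0 = frobenius (M *m v) ^+ 2.
    by rewrite -mxdotxx /mxdot /mxtrace big_ord1.
  by rewrite mulrCA expr2 ler_pM2l.
rewrite -(ler_pXn2r (n := 2))// ?nnegrE ?mulr_ge0 ?frobenius_ge0//.
rewrite exprMn !sqr_frobenius_cols mulr_sumr; apply: ler_sum => j _.
by rewrite !colE -mulmxA -exprMn ler_pXn2r// nnegrE ?mulr_ge0 ?frobenius_ge0.
Qed.

(* [Pi = W^T (W W^T)^-1 W] is the orthogonal projection onto the row space of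
   [D], so that [<M, D> = <M Pi, D>] and [|M Pi| <= t |Pi| = t sqrt (rank D)]. *)
Lemma mxdot_le_rank m n (M D : 'M[R]_(m, n)) (t : R) k :
  0 <= t ->
  (forall (u : 'cV_m) (v : 'cV_n),
     (u^T *m M *m v) ord0 ord0 <= t * (frobenius u * frobenius v)) ->
  (\rank D <= k)%N ->
  mxdot M D <= t * Num.sqrt k%:R * frobenius D.
Proof.
move=> t0 Mt Dk.
pose W := row_base D; pose G := W *m W^T.
(* If [v W W^T = 0] then [|v W|^2 = 0], and [W] has full row rank. *)
have Gu : G \in unitmx.
  rewrite -row_free_unit; apply: inj_row_free => v vG0.
  have vW0 : v *m W = 0.
    apply/eqP; rewrite -frobenius_eq0 -sqrf_eq0 -mxdotxx mxdot_mulr.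
    by rewrite -mulmxA vG0 /mxdot trmx0 mul0mx mxtrace0.
  by apply: (row_free_inj (row_base_free D)); rewrite /= mul0mx.
pose Pi := W^T *m invmx G *m W.
have WPi : W *m Pi = W by rewrite /Pi !mulmxA mulmxV// mul1mx.
have DPi : D *m Pi = D by rewrite -[D]mulmx_base -mulmxA WPi.
have PiT : Pi^T = Pi.
  have GT : G^T = G by rewrite /G trmx_mul trmxK.
  by rewrite /Pi (trmx_mul _ W) (trmx_mul W^T) (trmxK W) trmx_inv GT mulmxA.
have PiPi : Pi *m Pi = Pi by rewrite -[LHS]mulmxA WPi.
(* As [Pi] is symmetric and idempotent, [|Pi|^2] is its trace, which equals the rank by
   cyclicity. *)
have fPi : frobenius Pi <= Num.sqrt k%:R.
  rewrite -(ler_pXn2r (n := 2))// ?nnegrE ?frobenius_ge0 ?sqrtr_ge0//.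
  rewrite [leRHS]sqr_sqrtr// -mxdotxx /mxdot PiT PiPi.
  by rewrite /Pi -mulmxA mxtrace_mulC -mulmxA mulVmx// mxtrace1 ler_nat.
rewrite -{1}DPi mxdot_mulr PiT (le_trans (mxdot_le _ _))//.
rewrite ler_wpM2r ?frobenius_ge0//.
by rewrite (le_trans (frobenius_mulmx_le _ t0 Mt))// ler_wpM2l.
Qed.
End matrix_inner_product.

Section rayleigh.
Variables (R : realType) (p : nat) (S : 'M[R]_p).
Hypothesis S_sym : S^T = S.

Let quad (v : 'rV[R]_p) : R := mxdot v (v *m S).

Local Lemma continuous_coordM (i j : 'I_p) :
  continuous (fun v : 'rV[R]_p => v ord0 i * v ord0 j).
Proof.
move=> v.
exact: (cvgM (@coord_continuous R 1 p ord0 i v) (@coord_continuous R 1 p ord0 j v)).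
Qed.

Local Lemma continuous_quad : continuous quad.
Proof.
have -> : quad = (fun v => \sum_i \sum_j S j i * (v ord0 i * v ord0 j)).
  apply/funext => v; rewrite /quad mxdotE big_ord1; apply: eq_bigr => i _.
  by rewrite mxE mulr_sumr; apply: eq_bigr => j _; ring.
apply: continuous_sum => i; apply: continuous_sum => j v.
exact: (cvgM (cvg_cst (S j i)) (@continuous_coordM i j v)).
Qed.

Local Lemma compact_sphere : compact [set v : 'rV[R]_p | frobenius v = 1].
Proof.
have fE (v : 'rV[R]_p) : frobenius v ^+ 2 = \sum_i v ord0 i * v ord0 i.
  by rewrite frobenius_sq big_ord1.
apply: bounded_closed_compact.
  exists 1; split; first exact: num_real.
  move=> M M1 v /= v1; apply: (le_trans _ (ltW M1)).
  rewrite -[leLHS]/(mx_norm v).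
  have [->|/mx_norm_neq0[[i j]/= vij]] := eqVneq (mx_norm v) 0; first exact: ler01.
  rewrite vij -(ler_pXn2r (n := 2))// ?nnegrE// expr1n.
  rewrite real_normK ?num_real// ord1 -(expr1n _ 2) -v1 fE.
  by rewrite (bigD1 j)//= -expr2 lerDl sumr_ge0// => k _; rewrite -expr2 sqr_ge0.
rewrite (_ : [set _ | _] =
   (fun v : 'rV[R]_p => \sum_i v ord0 i * v ord0 i) @^-1` [set 1]).
  apply: preimage_closed; last exact: closed_eq.
  by move=> v _; apply: continuous_sum => i; exact: continuous_coordM.
apply/seteqP; split => v /=; rewrite -fE; first by move=> ->; rewrite expr1n.
move=> v1; by apply/eqP; rewrite -(eqrXn2 (n := 2))// ?frobenius_ge0// v1 expr1n.
Qed.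

Local Lemma quadZ (k : R) v : quad (k *: v) = k ^+ 2 * quad v.
Proof. by rewrite /quad -scalemxAl mxdotZr mxdotZl; ring. Qed.

(* A maximiser of the quadratic form on the sphere is an eigenvector. *)
Lemma rayleigh_le (b : R) : (forall a, eigenvalue S a -> a <= b) ->
  forall v : 'rV_p, mxdot v (v *m S) <= b * frobenius v ^+ 2.
Proof.
move=> Sb v; have [->|v0] := eqVneq v 0.
  by rewrite -mxdotxx /mxdot trmx0 !mul0mx mxtrace0 mulr0.
have unit (u : 'rV[R]_p) : u != 0 -> frobenius ((frobenius u)^-1 *: u) = 1.
  move=> u0; rewrite frobeniusZ ger0_norm ?invr_ge0 ?frobenius_ge0// mulVf//.
  by rewrite frobenius_eq0.
have [|v1 /set_mem/= fv1 v1max] := compact_EVT_max _ compact_sphere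
   (continuous_subspaceT continuous_quad).
  by exists ((frobenius v)^-1 *: v); exact: unit.
set mu := quad v1.
have quad_le u : quad u <= mu * frobenius u ^+ 2.
  have [->|u0] := eqVneq u 0.
    by rewrite /quad -mxdotxx /mxdot trmx0 !mul0mx mxtrace0 mulr0.
  have := v1max ((frobenius u)^-1 *: u) (mem_set (unit u u0)).
  rewrite quadZ exprVn ler_pdivrMl 1?mulrC//.
  by rewrite exprn_gt0// lt_def frobenius_ge0 frobenius_eq0 u0.
pose w := mu *: v1 - v1 *m S.
(* First variation at the maximiser: [mu |u|^2 - quad u] is nonnegative, and along [u = v1 + t w] it
   equals [2 t N + t^2 g]. A small negative [t] would make it negative unless [N = 0]. *)
have w0 : frobenius w ^+ 2 = 0.
  set N := frobenius w ^+ 2.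
  have N0 : 0 <= N by exact: sqr_ge0.
  pose g := mu * N - quad w.
  have g0 : 0 <= g by rewrite subr_ge0 quad_le.
  have quadD (t : R) : mu * frobenius (v1 + t *: w) ^+ 2 - quad (v1 + t *: w) =
      2 * t * N + t ^+ 2 * g.
    rewrite sqr_frobeniusD fv1 /quad mulmxDl !mxdotDr !mxdotDl -!scalemxAl.
    rewrite -/(quad v1) frobeniusZ exprMn real_normK ?num_real// -/N.
    rewrite !mxdotZr !mxdotZl -/(quad w).
    have -> : mxdot v1 (w *m S) = mxdot w (v1 *m S).
      by rewrite mxdot_mulr S_sym mxdotC.
    have NE : N = mu * mxdot v1 w - mxdot w (v1 *m S).
      rewrite /N -mxdotxx {2}/w mxdotDr mxdotZr mxdotNr.
      by rewrite [mxdot w v1]mxdotC.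
    by rewrite /g NE -/mu; ring.
  (* The denominator [g + 1] is positive even when [g] vanishes. *)
  have := quadD (- N / (g + 1)).
  have : 0 <= mu * frobenius (v1 + (- N / (g + 1)) *: w) ^+ 2 -
      quad (v1 + (- N / (g + 1)) *: w) by rewrite subr_ge0 quad_le.
  move=> /[swap] ->.
  have -> : 2 * (- N / (g + 1)) * N + (- N / (g + 1)) ^+ 2 * g =
     - (N ^+ 2 * ((g + 2) / (g + 1) ^+ 2)) by field; rewrite gt_eqF// ltr_wpDl.
  rewrite oppr_ge0 pmulr_lle0; last by rewrite divr_gt0// ?exprn_gt0// ltr_wpDl.
  by move=> N20; apply/eqP; rewrite -sqrf_eq0 eq_le N20 sqr_ge0.
rewrite (le_trans (quad_le v))// ler_wpM2r ?sqr_ge0// Sb//.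
apply/eigenvalueP; exists v1.
  by apply/eqP; rewrite eq_sym -subr_eq0 -frobenius_eq0 -sqrf_eq0 w0.
by rewrite -frobenius_eq0 fv1 oner_eq0.
Qed.
End rayleigh.

Lemma frobenius_le_add (R : realType) m n (A B : 'M[R]_(m, n)) :
  frobenius (A + B) <= frobenius A + frobenius B.
Proof.
rewrite -(ler_pXn2r (n := 2))// ?nnegrE ?addr_ge0 ?frobenius_ge0//.
rewrite sqr_frobeniusD sqrrD lerD2r lerD2l -[leRHS]mulr_natl ler_wpM2l//.
exact: mxdot_le.
Qed.

Lemma frobenius0 (R : realType) m n : frobenius (0 : 'M[R]_(m, n)) = 0.
Proof. by apply/eqP; rewrite frobenius_eq0. Qed.

Lemma mxdot_rows (R : realType) m n (A B : 'M[R]_(m, n)) :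
  mxdot A B = \sum_i mxdot (row i A) (row i B).
Proof.
rewrite mxdotE; apply: eq_bigr => i _; rewrite mxdotE big_ord1.
by apply: eq_bigr => j _; rewrite !mxE.
Qed.

Lemma frobenius_tr (R : realType) m n (A : 'M[R]_(m, n)) : frobenius A^T = frobenius A.
Proof.
apply/eqP; rewrite -(eqrXn2 (n := 2))// ?frobenius_ge0// !frobenius_sq exchange_big/=.
by apply/eqP; apply: eq_bigr => i _; apply: eq_bigr => j _; rewrite mxE.
Qed.

Section norm_sums.
Variables (R : realType) (I : finType) (P : pred I) (x : I -> R).
Hypothesis x0 : forall i, 0 <= x i.

Lemma sum_sqr_le_sqr_sum : \sum_(i | P i) x i ^+ 2 <= (\sum_(i | P i) x i) ^+ 2.
Proof.
rewrite [leRHS]expr2 mulr_suml; apply: ler_sum => i Pi.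
by rewrite expr2 ler_wpM2l// (bigD1 i)//= lerDl sumr_ge0.
Qed.

(** Cauchy-Schwarz against constant weights, from [x_i x_j <= (x_i^2 + x_j^2) / 2] summed over
    pairs. *)
Lemma sqr_sum_le : (\sum_(i | P i) x i) ^+ 2 <= #|P|%:R * \sum_(i | P i) x i ^+ 2.
Proof.
rewrite expr2 big_distrlr/=.
apply: (@le_trans _ _ (\sum_(i | P i) \sum_(j | P j) ((x i ^+ 2 + x j ^+ 2) / 2))).
  apply: ler_sum => i _; apply: ler_sum => j _.
  by have := sqr_ge0 (x i - x j); nra.
set Q := \sum_(i | P i) x i ^+ 2.
have inner i : \sum_(j | P j) ((x i ^+ 2 + x j ^+ 2) / 2) = (#|P|%:R * x i ^+ 2 + Q) / 2.
  by rewrite -mulr_suml big_split/= sumr_const mulr_natl.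
under eq_bigr do rewrite inner.
rewrite -mulr_suml big_split/= sumr_const -mulr_sumr -/Q -[X in _ + X]mulr_natl.
by rewrite le_eqVlt; apply/orP; left; apply/eqP; field.
Qed.
End norm_sums.

(** * Splitting a coefficient matrix into relevant and irrelevant rows *)

Section row_mask.
Variables (R : realType) (p q s : nat).
Implicit Types A B : 'M[R]_(p, q).

Definition mask_rows A : 'M[R]_(p, q) := \matrix_(i, j) (A i j *+ (i < s)%N).

Lemma row_mask_rows A i : row i (mask_rows A) = if (i < s)%N then row i A else 0.
Proof. by apply/rowP => j; rewrite !mxE; case: ifP; rewrite ?mulr1n !mxE. Qed.

Lemma mask_rowsD A B : mask_rows (A - B) = mask_rows A - mask_rows B.
Proof. by apply/matrixP => i j; rewrite !mxE mulrnBl. Qed.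

(** Masking is left multiplication by a 0-1 diagonal matrix. This keeps the masked estimator
    feasible in the rank-constrained problem. *)
Lemma rank_mask_rows A : (\rank (mask_rows A) <= \rank A)%N.
Proof.
have -> : mask_rows A = diag_mx (\row_i (i < s)%:R) *m A.
  by apply/matrixP => i j; rewrite mul_diag_mx !mxE mulr_natl.
exact: mxrankM_maxr.
Qed.

Lemma sqr_frobenius_mask A :
  frobenius (mask_rows A) ^+ 2 = \sum_(j < p | (j < s)%N) frobenius (row j A) ^+ 2.
Proof.
rewrite sqr_frobenius_rows [RHS]big_mkcond/=; apply: eq_bigr => j _.
by rewrite row_mask_rows; case: ifP => // _; rewrite frobenius0 expr0n.
Qed.

Lemma sqr_frobenius_maskC A : frobenius (A - mask_rows A) ^+ 2 =
  \sum_(j < p | (s <= j)%N) frobenius (row j A) ^+ 2.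
Proof.
rewrite sqr_frobenius_rows [RHS]big_mkcond/=; apply: eq_bigr => j _.
rewrite linearB/= row_mask_rows [(s <= j)%N]leqNgt; case: ifP => _ /=; last by rewrite subr0.
by rewrite subrr frobenius0 expr0n.
Qed.

Lemma sum_row_norms_ge0 (P : pred 'I_p) A :
  0 <= \sum_(j | P j) frobenius (row j A).
Proof. by apply: sumr_ge0 => j _; exact: frobenius_ge0. Qed.

Lemma frobenius_maskC_le A : frobenius (A - mask_rows A) <=
  \sum_(j < p | (s <= j)%N) frobenius (row j A).
Proof.
rewrite -(ler_pXn2r (n := 2))// ?nnegrE ?sum_row_norms_ge0 ?frobenius_ge0//.
by rewrite sqr_frobenius_maskC sum_sqr_le_sqr_sum// => j; exact: frobenius_ge0.
Qed.

Lemma frobenius_mask_le A : frobenius (mask_rows A) <=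
  \sum_(j < p | (j < s)%N) frobenius (row j A).
Proof.
rewrite -(ler_pXn2r (n := 2))// ?nnegrE ?sum_row_norms_ge0 ?frobenius_ge0//.
by rewrite sqr_frobenius_mask sum_sqr_le_sqr_sum// => j; exact: frobenius_ge0.
Qed.

Hypothesis sp : (s <= p)%N.

Lemma sum_first_rows (F : 'I_p -> R) :
  \sum_(j < p | (j < s)%N) F j = \sum_(i < s) F (widen_ord sp i).
Proof. by rewrite (big_ord_narrow sp). Qed.

Lemma sum_rows_le A : \sum_(j < p | (j < s)%N) frobenius (row j A) <=
  Num.sqrt s%:R * frobenius (mask_rows A).
Proof.
rewrite -(ler_pXn2r (n := 2))// ?nnegrE ?sum_row_norms_ge0 ?mulr_ge0 ?frobenius_ge0//.
rewrite exprMn [Num.sqrt _ ^+ 2]sqr_sqrtr// sqr_frobenius_mask.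
apply: (le_trans (sqr_sum_le _ _)).
rewrite ler_wpM2r//; first by apply: sumr_ge0 => j _; exact: sqr_ge0.
by rewrite ler_nat -sum1_card (big_ord_narrow sp) sum1_card card_ord.
Qed.

(** The block kept by [mask_rows], but with only [s] rows, so that the nets controlling the noise on
    it have total dimension [s + q] instead of [p + q]. *)
Definition first_rows A : 'M[R]_(s, q) := rowsub (widen_ord sp) A.

Lemma row_first_rows A i : row i (first_rows A) = row (widen_ord sp i) A.
Proof. by rewrite row_rowsub. Qed.

Lemma frobenius_first_rows A : frobenius (first_rows A) = frobenius (mask_rows A).
Proof.
apply/eqP; rewrite -(eqrXn2 (n := 2))// ?frobenius_ge0// sqr_frobenius_mask.
rewrite sum_first_rows sqr_frobenius_rows; apply/eqP; apply: eq_bigr => i _.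
by rewrite row_first_rows.
Qed.

Lemma rank_first_rows A : (\rank (first_rows A) <= \rank A)%N.
Proof. by apply/mxrankS/row_subP => i; rewrite row_rowsub row_sub. Qed.

(** Separates the part of the noise term handled by rank and operator norm from the part handled row
    by row. *)
Lemma mxdot_first_rows A B :
  mxdot A B = mxdot (first_rows A) (first_rows B) +
    \sum_(j < p | (s <= j)%N) mxdot (row j A) (row j B).
Proof.
rewrite mxdot_rows (bigID (fun j : 'I_p => (j < s)%N))/=; congr (_ + _).
  rewrite sum_first_rows mxdot_rows; apply: eq_bigr => i _.
  by rewrite !row_first_rows.
by apply: eq_bigl => j; rewrite -leqNgt.
Qed.
End row_mask.

(** * Deterministic bounds on the estimation error *)

Lemma sample_cov_quadE (R : realType) n p (X : 'M[R]_(n, p)) (v : 'rV_p) :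
  (0 < n)%N ->
  mxdot v (v *m sample_cov X) = n%:R^-1 * frobenius (X *m v^T) ^+ 2.
Proof.
move=> n0; rewrite /sample_cov -scalemxAr mxdotZr; congr (_ * _).
by rewrite mulmxA mxdot_mulr mxdotxx -[in RHS]frobenius_tr trmx_mul trmxK.
Qed.

Lemma sample_cov_sym (R : realType) n p (X : 'M[R]_(n, p)) :
  (sample_cov X)^T = sample_cov X.
Proof. by rewrite /sample_cov linearZ/= trmx_mul trmxK. Qed.

(** For each column [v] of [A], [|X v|^2] is [n] times the quadratic form of the sample covariance
    at [v], to which the Rayleigh bound applies. *)
Lemma frobenius_design_le (R : realType) n p q (X : 'M[R]_(n, p)) (b : R) :
  (0 < n)%N -> 0 <= b -> (forall a, eigenvalue (sample_cov X) a -> a <= b) ->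
  forall A : 'M[R]_(p, q),
    frobenius (X *m A) <= Num.sqrt (n%:R * b) * frobenius A.
Proof.
move=> n0 b0 Xb A.
have nR : 0 < n%:R :> R by rewrite ltr0n.
rewrite -(ler_pXn2r (n := 2))// ?nnegrE ?mulr_ge0 ?frobenius_ge0//.
rewrite exprMn (@sqr_sqrtr _ (n%:R * b)) ?mulr_ge0//.
rewrite !sqr_frobenius_cols mulr_sumr; apply: ler_sum => j _.
rewrite !colE -mulmxA -colE.
have := rayleigh_le (sample_cov_sym X) Xb (col j A)^T.
by rewrite sample_cov_quadE// trmxK frobenius_tr ler_pdivrMl// mulrA.
Qed.

Lemma restricted_eigenvalue_le (R : realType) n p q s (X : 'M[R]_(n, p)) (c : R)
    (D : 'M[R]_(p, q)) :
  (0 < n)%N -> restricted_eigenvalue q s (sample_cov X) c ->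
  \sum_(j < p | (s <= j)%N) frobenius (row j D)
    <= 2 * \sum_(j < p | (j < s)%N) frobenius (row j D) ->
  n%:R * c * frobenius (mask_rows s D) ^+ 2 <= frobenius (X *m D) ^+ 2.
Proof.
move=> n0 rX /rX; rewrite -sqr_frobenius_mask.
have nR : 0 < n%:R :> R by rewrite ltr0n.
have -> : \tr (D^T *m sample_cov X *m D) = n%:R^-1 * frobenius (X *m D) ^+ 2.
  rewrite -mxdotxx /mxdot trmx_mul /sample_cov -scalemxAr -scalemxAl mxtraceZ.
  by rewrite !mulmxA.
by rewrite ler_pdivlMl// mulrA.
Qed.

Section objective_comparison.
Variables (R : realType) (n p q r s : nat).
Variables (X : 'M[R]_(n, p)) (C0 Ch : 'M[R]_(p, q)) (E : 'M[R]_(n, q)).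
Variable lam : 'I_p -> R.
Hypothesis sol : is_srrr_solution r (X *m C0 + E) X lam Ch.
Hypothesis C0_rows : forall j : 'I_p, (s <= j)%N -> row j C0 = 0.
Hypothesis lam0 : forall j, 0 <= lam j.

Let D := Ch - C0.
Let residual_norm (C : 'M[R]_(p, q)) : frobenius (X *m C0 + E - X *m C) ^+ 2 =
  frobenius E ^+ 2 - 2 * mxdot (X^T *m E) (C - C0) + frobenius (X *m (C - C0)) ^+ 2.
Proof.
have -> : X *m C0 + E - X *m C = E + - (X *m (C - C0)).
  by rewrite mulmxBr opprB addrAC addrC.
by rewrite sqr_frobeniusD frobeniusN mxdotNr mxdot_mull mulrN.
Qed.

(** Optimality of [Ch] against the true matrix. The penalty difference is bounded by the triangle
    inequality on relevant rows; on the others [C0] vanishes, so the rows of [D] are those of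
    [Ch]. *)
Lemma basic_inequality (l1 l2 : R) : (\rank C0 <= r)%N ->
  (forall j : 'I_p, (j < s)%N -> lam j <= l1) ->
  (forall j : 'I_p, (s <= j)%N -> l2 <= lam j) ->
  frobenius (X *m D) ^+ 2 + n%:R * (l2 * \sum_(j < p | (s <= j)%N) frobenius (row j D))
  <= 2 * mxdot (X^T *m E) D
     + n%:R * (l1 * \sum_(j < p | (j < s)%N) frobenius (row j D)).
Proof.
move=> rC0 lam1 lam2; have := sol.2 C0 rC0.
rewrite /srrr_objective !residual_norm subrr mulmx0 frobenius0 -/D.
rewrite (_ : mxdot _ 0 = 0); last by rewrite /mxdot mulmx0 mxtrace0.
have : \sum_j lam j * frobenius (row j C0) - \sum_j lam j * frobenius (row j Ch) <=
    l1 * (\sum_(j < p | (j < s)%N) frobenius (row j D)) -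
    l2 * (\sum_(j < p | (s <= j)%N) frobenius (row j D)).
  rewrite -sumrB (bigID (fun j : 'I_p => (j < s)%N))/= lerD//.
    rewrite mulr_sumr; apply: ler_sum => j js.
    apply: (@le_trans _ _ (lam j * frobenius (row j D))); last first.
      by rewrite ler_wpM2r ?frobenius_ge0// lam1.
    rewrite -mulrBr ler_wpM2l// lerBlDr.
    rewrite [leLHS](_ : _ = frobenius (- row j D + row j Ch)); last first.
      by congr frobenius; rewrite /D linearB/= opprB subrK.
    by rewrite (le_trans (frobenius_le_add _ _))// frobeniusN.
  rewrite mulr_sumr -sumrN; under eq_bigl do rewrite -leqNgt.
  apply: ler_sum => j sj; rewrite C0_rows// frobenius0 mulr0 sub0r lerN2.
  rewrite /D linearB/= C0_rows// subr0.
  by rewrite ler_wpM2r ?frobenius_ge0// lam2.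
move=> /(ler_wpM2l (ler0n R n)).
rewrite !mulrBr => H1 H2; lra.
Qed.

(* The competitor is [Ch] with its irrelevant rows set to zero. *)
Lemma sparsity_inequality (l2 : R) :
  (forall j : 'I_p, (s <= j)%N -> l2 <= lam j) ->
  n%:R * (l2 * \sum_(j < p | (s <= j)%N) frobenius (row j D))
  <= 2 * mxdot (X^T *m E) (D - mask_rows s D)
     + 2 * (frobenius (X *m mask_rows s D) * frobenius (X *m (D - mask_rows s D))).
Proof.
move=> lam2.
have rC : (\rank (mask_rows s Ch) <= r)%N by rewrite (leq_trans (rank_mask_rows _ _))// sol.1.
have maskC0 : mask_rows s C0 = C0.
  apply/row_matrixP => j; rewrite row_mask_rows; case: ltnP => // sj.
  by rewrite C0_rows.
have := sol.2 _ rC; rewrite /srrr_objective !residual_norm -/D.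
have -> : mask_rows s Ch - C0 = mask_rows s D.
  by rewrite /D mask_rowsD maskC0.
set G := D - mask_rows s D.
have DE : D = mask_rows s D + G by rewrite /G addrC subrK.
have -> : frobenius (X *m D) ^+ 2 = frobenius (X *m mask_rows s D) ^+ 2
   + 2 * mxdot (X *m mask_rows s D) (X *m G) + frobenius (X *m G) ^+ 2.
  by rewrite {1}DE mulmxDr sqr_frobeniusD.
have -> : mxdot (X^T *m E) D = mxdot (X^T *m E) (mask_rows s D) + mxdot (X^T *m E) G.
  by rewrite {1}DE mxdotDr.
(* The loss in fit from dropping [G] is a noise term, this cross term, and [- |X G|^2], whose sign
   is favourable. *)
have CS : - mxdot (X *m mask_rows s D) (X *m G) <=
    frobenius (X *m mask_rows s D) * frobenius (X *m G).
  by rewrite -mxdotNr (le_trans (mxdot_le _ _))// frobeniusN.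
have G2 := sqr_ge0 (frobenius (X *m G)).
have : l2 * (\sum_(j < p | (s <= j)%N) frobenius (row j D)) <=
    \sum_j lam j * frobenius (row j Ch) -
    \sum_j lam j * frobenius (row j (mask_rows s Ch)).
  rewrite -sumrB [leRHS](bigID (fun j : 'I_p => (j < s)%N))/= [X in X + _]big1 ?add0r; last first.
    by move=> j js; rewrite row_mask_rows js subrr.
  rewrite mulr_sumr [leRHS](eq_bigl (fun j : 'I_p => (s <= j)%N)); last first.
    by move=> j; rewrite -leqNgt.
  apply: ler_sum => j sj; rewrite row_mask_rows ltnNge sj/= frobenius0 mulr0 subr0.
  rewrite /D linearB/= C0_rows// subr0.
  by rewrite ler_wpM2r ?frobenius_ge0// lam2.
move=> /(ler_wpM2l (ler0n R n)); rewrite mulrBr => H1 H2; lra.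
Qed.
End objective_comparison.


(** * Arithmetic of the rate [r (q + s - r)] *)

Lemma srrr_rateE (R : realType) q s r : (r <= q)%N ->
  srrr_rate R q s r = (r * (q + s - r))%:R.
Proof.
move=> rq; rewrite /srrr_rate natrM natrB ?natrD//.
by rewrite (leq_trans rq)// leq_addr.
Qed.

(** If [r <= s], then [2 r <= q + s], hence [s + q <= 2 (q + s - r)]. If [s < r], the rank is capped
    by [s], and the products of [s] with [s], [r] and [q - r] are each bounded by [r s] or
    [r (q - r)]. *)
Lemma rank_times_dim_le_rate q s r : (0 < r <= q)%N -> (0 < s)%N ->
  (minn (2 * r) s * (s + q) <= 4 * (r * (q + s - r)))%N.
Proof.
move=> /andP[r0 rq] s0; have [rs|sr] := leqP r s.
  apply: (@leq_trans (2 * r * (s + q))); first by rewrite leq_mul2r geq_minl orbT.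
  nia.
apply: (@leq_trans (s * (s + q))); first by rewrite leq_mul2r geq_minr orbT.
have [y ry] : exists y, r = (s + y)%N by exists (r - s)%N; lia.
have [x qx] : exists x, q = (r + x)%N by exists (q - r)%N; lia.
subst q r; nia.
Qed.

(** The rate is [r (q - r) + r s], whose terms dominate [q - r] and [r]. It makes the rate positive
    and lets it pay for a net in dimension [q]. *)
Lemma response_dim_le_rate q s r : (0 < r <= q)%N -> (0 < s)%N ->
  (q <= r * (q + s - r))%N.
Proof.
move=> /andP[r0 rq] s0; have [rs|sr] := leqP r s; first by nia.
have [y ry] : exists y, r = (s + y)%N by exists (r - s)%N; lia.
have [x qx] : exists x, q = (r + x)%N by exists (q - r)%N; lia.
subst q r; nia.
Qed.

(** * Error bounds for a fixed sample size when the noise is controlled *)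

Section estimation_error.
Variables (R : realType) (n p q r s : nat).
Variables (X : 'M[R]_(n, p)) (C0 Ch : 'M[R]_(p, q)) (E : 'M[R]_(n, q)).
Variable lam : 'I_p -> R.
Variables (c b K L B : R).
Hypotheses (n0 : (0 < n)%N) (rpq : (0 < r <= q)%N) (s0 : (0 < s)%N) (sp : (s <= p)%N).
Hypotheses (p1 : (0 < p)%N).
Hypothesis sol : is_srrr_solution r (X *m C0 + E) X lam Ch.
Hypothesis C0_rank : (\rank C0 <= r)%N.
Hypothesis C0_rows : forall j : 'I_p, (s <= j)%N -> row j C0 = 0.
Hypothesis lam0 : forall j, 0 <= lam j.
Hypotheses (c0 : 0 < c) (b0 : 0 <= b) (K0 : 0 <= K) (L0 : 0 <= L).
Hypothesis rX : restricted_eigenvalue q s (sample_cov X) c.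
Hypothesis Xb : forall a, eigenvalue (sample_cov X) a -> a <= b.

(** [rho] is the target rate for the coefficients, and [sigma >= rho] is the scale dominated by the
    penalty on irrelevant rows. [W] adds the noise constant [4 K] and the penalty constant [L] of
    the relevant rows. *)
Let a : R := srrr_rate R q s r.
Let N : R := n%:R.
Let rho := Num.sqrt (a / N).
Let sigma := Num.sqrt ((q%:R * ln p%:R + a) / N).
Let W := 4 * K + L.

Hypothesis lam1 : forall j : 'I_p, (j < s)%N -> lam j <= L * Num.sqrt (a / (N * s%:R)).
Hypothesis lam2 : forall j : 'I_p, (s <= j)%N -> B * sigma <= lam j.
(** The terms [2 K + W + 1] yield the cone condition; [2 b (W / c)] absorbs the change of fit when
    irrelevant rows are zeroed. *)
Hypothesis B_large : 2 * K + W + 1 + 2 * b * (W / c) <= B.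
Hypothesis noise_S : forall (u : 'cV_s) (v : 'cV_q),
  (u^T *m first_rows sp (X^T *m E) *m v) ord0 ord0
    <= K * Num.sqrt (N * (s + q)%:R) * (frobenius u * frobenius v).
Hypothesis noise_rows : forall (j : 'I_p) (v : 'cV_q), (s <= j)%N ->
  (row j (X^T *m E) *m v) ord0 ord0
    <= K * Num.sqrt (N * (q%:R * ln p%:R + a)) * frobenius v.

Let D := Ch - C0.
Let F := frobenius (mask_rows s D).
Let S := \sum_(j < p | (s <= j)%N) frobenius (row j D).

Let N0 : 0 < N. Proof. by rewrite ltr0n. Qed.
Let a0 : 0 < a.
Proof.
have /andP[r0 rq] := rpq.
rewrite /a srrr_rateE// ltr0n (leq_trans _ (response_dim_le_rate rpq s0))//.
exact: leq_trans rq.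
Qed.
Let lnp0 : 0 <= ln p%:R :> R. Proof. by rewrite ln_ge0// ler1n. Qed.
Let rho0 : 0 < rho. Proof. by rewrite sqrtr_gt0 divr_gt0. Qed.
Let rho_sigma : rho <= sigma.
Proof.
apply: ler_wsqrtr; rewrite ler_wpM2r ?invr_ge0// ?ler0n//.
by rewrite lerDr mulr_ge0.
Qed.

Let sqrtN x : 0 <= x -> Num.sqrt (N * x) = N * Num.sqrt (x / N).
Proof.
move=> x0; rewrite -{2}(ger0_norm (ltW N0)) -sqrtr_sqr -sqrtrM ?sqr_ge0//.
by congr Num.sqrt; field; rewrite gt_eqF.
Qed.

Let sqrt_noise : Num.sqrt (N * (q%:R * ln p%:R + a)) = N * sigma.
Proof.
have qlnp0 : 0 <= q%:R * ln p%:R :> R by exact: mulr_ge0.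
by rewrite sqrtN// addr_ge0// ltW.
Qed.

Let rank_D : (\rank (first_rows sp D) <= minn (2 * r) s)%N.
Proof.
rewrite leq_min rank_leq_row andbT (leq_trans (rank_first_rows _ _))//.
rewrite (leq_trans (mxrank_add _ _))// mxrank_opp mul2n -addnn leq_add//.
exact: sol.1.
Qed.

Let noise_rows_sum (A : 'M[R]_(p, q)) :
  \sum_(j < p | (s <= j)%N) mxdot (row j (X^T *m E)) (row j A) <=
  K * N * sigma * \sum_(j < p | (s <= j)%N) frobenius (row j A).
Proof.
rewrite mulr_sumr; apply: ler_sum => j sj.
have := noise_rows (row j A)^T sj.
rewrite sqrt_noise frobenius_tr mulrA; apply: le_trans.
rewrite mxdotE big_ord1 mxE; apply: ler_sum => k _.
by rewrite [(row j A)^T _ _]mxE.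
Qed.

(** On the relevant block, operator norm times square root of the rank gives at most
    [K sqrt (4 N a) F = 2 K N rho F]. *)
Let noise_D : mxdot (X^T *m E) D <= 2 * K * N * rho * F + K * N * sigma * S.
Proof.
rewrite (mxdot_first_rows sp) lerD// ?noise_rows_sum//.
apply: (le_trans (mxdot_le_rank _ noise_S rank_D)); first by rewrite mulr_ge0.
rewrite frobenius_first_rows -/F ler_wpM2r ?frobenius_ge0//.
rewrite -mulrA -sqrtrM ?mulr_ge0// ?(ltW N0)//.
rewrite (_ : N * _ * _ = N * (minn (2 * r) s * (s + q))%:R); last first.
  by rewrite (natrM _ (minn _ _)); ring.
rewrite (mulrC 2) -!mulrA ler_wpM2l//.
apply: (@le_trans _ _ (Num.sqrt (N * (2 ^+ 2 * a)))).
  apply: ler_wsqrtr; rewrite ler_wpM2l ?(ltW N0)// /a srrr_rateE; last by case/andP: rpq.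
  by rewrite -natrX -natrM ler_nat rank_times_dim_le_rate.
rewrite mulrCA sqrtrM// sqrtr_sqr ger0_norm// sqrtN ?(ltW a0)//.
Qed.

(** The factor [sqrt s] from summing the relevant row norms cancels the [1 / sqrt s] in the bound on
    their penalties. *)
Let main_inequality :
  frobenius (X *m D) ^+ 2 + N * B * sigma * S <= W * N * rho * F + 2 * K * N * sigma * S.
Proof.
have := basic_inequality sol C0_rows lam0 C0_rank lam1 lam2.
rewrite -/D -/S -/N.
have : L * Num.sqrt (a / (N * s%:R)) * (\sum_(j < p | (j < s)%N) frobenius (row j D)) <=
    L * rho * F.
  apply: (@le_trans _ _ (L * Num.sqrt (a / (N * s%:R)) * (Num.sqrt s%:R * F))).
    by rewrite ler_wpM2l ?mulr_ge0//; exact: sum_rows_le.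
  rewrite mulrA -[_ * Num.sqrt s%:R]mulrA -sqrtrM; last first.
    by apply: divr_ge0; [exact: ltW|apply: mulr_ge0].
  rewrite (_ : a / (N * s%:R) * s%:R = a / N)//; field.
  by rewrite !gt_eqF// ltr0n.
move=> /(ler_wpM2l (ltW N0)); move: noise_D; rewrite /W => h1 h2 h3.
nra.
Qed.

Let F0 : 0 <= F. Proof. exact: frobenius_ge0. Qed.
Let S0 : 0 <= S. Proof. exact: sum_row_norms_ge0. Qed.
Let W0 : 0 <= W. Proof. by rewrite /W addr_ge0 ?mulr_ge0. Qed.
Let M0 : 0 <= W / c. Proof. by rewrite divr_ge0// ltW. Qed.
Let B1 : 2 * K + W + 1 <= B.
Proof. by apply: le_trans B_large; rewrite lerDl; apply: mulr_ge0 => //; exact: mulr_ge0. Qed.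

(** Drop the fit term and use [B - 2 K >= W + 1] with [sigma >= rho]. The extra 1 keeps the common
    factor positive when [W = 0]. *)
Let cone : S <= F.
Proof.
have h : N * (W + 1) * rho * S <= N * (W + 1) * rho * F.
  apply: (@le_trans _ _ (N * (B - 2 * K) * sigma * S)).
    rewrite ler_wpM2r//; apply: ler_pM => //.
    - by apply: mulr_ge0; [exact: ltW|rewrite addr_ge0].
    - exact: ltW.
    - by rewrite ler_wpM2l ?(ltW N0)//; have := B1; lra.
  apply: (@le_trans _ _ (W * N * rho * F)).
    have := main_inequality; have := sqr_ge0 (frobenius (X *m D)); lra.
  rewrite ler_wpM2r// ler_wpM2r ?(ltW rho0)// mulrC ler_wpM2l ?(ltW N0)//.
  by rewrite lerDl.
by move: h; rewrite ler_pM2l// !mulr_gt0// ltr_wpDl.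
Qed.

Let fit_le : frobenius (X *m D) ^+ 2 <= W * N * rho * F.
Proof.
have : 0 <= N * (B - 2 * K) * sigma * S.
  rewrite !mulr_ge0 ?(ltW N0) ?sqrtr_ge0//.
  have := B1; have := W0; lra.
have := main_inequality; lra.
Qed.

(** The cone condition activates the restricted eigenvalue bound, so [N c F^2 <= W N rho F]; one
    factor [F] cancels when nonzero. *)
Let F_le : F <= W / c * rho.
Proof.
have : N * c * F ^+ 2 <= W * N * rho * F.
  apply: le_trans fit_le; apply: restricted_eigenvalue_le => //.
  rewrite -/S (le_trans cone)// (le_trans (frobenius_mask_le _ _))//.
  by rewrite ler_peMl ?sum_row_norms_ge0// ler1n.
have [->|Fn0] := eqVneq F 0; first by rewrite mulr_ge0 ?(ltW rho0).
have Fgt0 : 0 < F by rewrite lt_def Fn0.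
rewrite expr2 mulrA ler_pM2r// -ler_pdivlMl ?mulr_gt0//.
by congr (_ <= _); field; rewrite !gt_eqF.
Qed.

Lemma prediction_error : frobenius (X *m D) <= Num.sqrt (W * (W / c)) * Num.sqrt a.
Proof.
rewrite -(ler_pXn2r (n := 2))// ?nnegrE ?mulr_ge0 ?frobenius_ge0 ?sqrtr_ge0//.
rewrite exprMn (sqr_sqrtr (mulr_ge0 W0 M0)) (sqr_sqrtr (ltW a0)).
apply: (le_trans fit_le).
have -> : a = N * rho ^+ 2.
  by rewrite /rho (@sqr_sqrtr _ (a / N)) ?divr_ge0 ?(ltW a0) ?(ltW N0)//; field; rewrite gt_eqF.
have := ler_wpM2l (mulr_ge0 (mulr_ge0 W0 (ltW N0)) (ltW rho0)) F_le.
lra.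
Qed.

Lemma coefficient_error : frobenius D <= 2 * (W / c) * rho.
Proof.
apply: (@le_trans _ _ (F + F)); last by have := F_le; lra.
have {1}-> : D = mask_rows s D + (D - mask_rows s D) by rewrite addrC subrK.
apply: (le_trans (frobenius_le_add _ _)); rewrite lerD//.
exact: (le_trans (frobenius_maskC_le _ _)).
Qed.

(** In the sparsity inequality the noise is at most [K N sigma S] and the product of fits at most
    [N b F S], with [F <= (W / c) sigma]. Since [B] exceeds the resulting constants, a positive
    multiple of [S] is at most 0. *)
Lemma irrelevant_rows_eq0 (j : 'I_p) : (s <= j)%N -> row j Ch = 0.
Proof.
move=> sj; apply/eqP; rewrite -frobenius_eq0.
have S_eq0 : S = 0.
  apply/eqP; rewrite eq_le S0 andbT.
  have := sparsity_inequality sol C0_rows lam2; rewrite -/D -/S -/N.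
  set G := D - mask_rows s D.
  have noiseG : mxdot (X^T *m E) G <= K * N * sigma * S.
    rewrite (mxdot_first_rows sp).
    have -> : first_rows sp G = 0.
      by apply/row_matrixP => i; rewrite row_first_rows /G linearB/= row_mask_rows/= ltn_ord subrr row0.
    rewrite /mxdot mulmx0 mxtrace0 add0r (le_trans (noise_rows_sum _))//.
    rewrite le_eqVlt; apply/orP; left; apply/eqP; congr (_ * _).
    by apply: eq_bigr => k sk; rewrite /G linearB/= row_mask_rows ltnNge sk/= subr0.
  have XG : frobenius (X *m G) <= Num.sqrt (N * b) * S.
    rewrite (le_trans (frobenius_design_le n0 b0 Xb G))// ler_wpM2l//.
    exact: frobenius_maskC_le.
  have XF : frobenius (X *m mask_rows s D) <= Num.sqrt (N * b) * F.
    exact: frobenius_design_le.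
  have XX : frobenius (X *m mask_rows s D) * frobenius (X *m G) <= N * b * (W / c) * sigma * S.
    apply: (le_trans (ler_pM (frobenius_ge0 _) (frobenius_ge0 _) XF XG)).
    rewrite mulrACA -expr2 (@sqr_sqrtr _ (N * b)) ?mulr_ge0 ?(ltW N0)// mulrA ler_wpM2r//.
    rewrite -[leRHS]mulrA ler_wpM2l ?mulr_ge0 ?(ltW N0)//.
    by rewrite (le_trans F_le)// ler_wpM2l.
  move=> H.
  have sig0 : 0 < sigma by apply: lt_le_trans rho_sigma.
  have NS : 0 < N * sigma by rewrite mulr_gt0.
  rewrite -(pmulr_rle0 _ NS).
  have h1 : (B - 2 * K - 2 * b * (W / c)) * (N * sigma * S) <= 0 by lra.
  have h2 : 0 < B - 2 * K - 2 * b * (W / c) by have := B_large; have := W0; lra.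
  by move: h1; rewrite (pmulr_rle0 _ h2).
have : \sum_(j < p | (s <= j)%N) frobenius (row j D) == 0 by apply/eqP.
rewrite psumr_eq0 => [/allP/(_ j (mem_index_enum _))|k _]; last exact: frobenius_ge0.
by rewrite sj /= /D linearB/= C0_rows// subr0.
Qed.
End estimation_error.

(** * The noise event *)

Lemma measure_exists_le d (T : measurableType d) (R : realType)
    (P : probability T R) (I : finType) (Q : pred I) (A : I -> set T) (e : R) :
  (forall i, measurable (A i)) -> (forall i, Q i -> (P (A i) <= e%:E)%E) ->
  measurable [set w | exists2 i, Q i & A i w] /\
  (P [set w | exists2 i, Q i & A i w] <= (#|Q|%:R * e)%:E)%E.
Proof.
move=> mA PA.
rewrite (_ : [set w | _] = \big[setU/set0]_(i | Q i) A i); last first.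
  apply/seteqP; split => w /=.
    by case=> i Qi Aiw; rewrite (bigD1 i)//=; left.
  elim/big_ind: _ => //; first by move=> B C hB hC [/hB|/hC].
  by move=> i Qi Aiw; exists i.
split; first by apply: bigsetU_measurable.
have -> : #|Q|%:R * e = \sum_(i | Q i) e by rewrite sumr_const mulr_natl.
rewrite -sumEFin.
pose meas_le (B : set T) (x : \bar R) := measurable B /\ (P B <= x)%E.
suff [] : meas_le (\big[setU/set0]_(i | Q i) A i) (\sum_(i | Q i) e%:E)%E by [].
elim/big_rec2: _ => [|i B x Qi [mB Bx]]; first by split; rewrite ?measure0.
split; first exact: measurableU.
by rewrite (le_trans (measureU2 _ _ _))// leeD// PA.
Qed.

Lemma first_rows_mul (R : realType) p q k s (sp : (s <= p)%N)
    (A : 'M[R]_(p, q)) (B : 'M[R]_(q, k)) :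
  first_rows sp (A *m B) = first_rows sp A *m B.
Proof. by rewrite /first_rows mul_rowsub_mx. Qed.

Section noise_event.
Context d (T : measurableType d) (R : realType) (P : probability T R).
Variables (n p q s : nat) (E : T -> 'M[R]_(n, q)) (X : 'M[R]_(n, p)).
Variables (c b K a delta : R).
Hypotheses (n0 : (0 < n)%N) (p0 : (0 < p)%N) (q0 : (0 < q)%N) (s0 : (0 < s)%N)
  (sp : (s <= p)%N).
Hypotheses (c0 : 0 < c) (b0 : 0 < b) (K0 : 0 <= K) (qa : q%:R <= a) (delta1 : delta <= 1).
Hypothesis mE : random_matrix E.
Hypothesis indepE : independent_vectors P (fun i w => row i (E w)).
Hypothesis subgE : forall (i : 'I_n) (t : R) (eta : 'cV[R]_q),
  ('E_P[fun w => (expR (t * (row i (E w) *m eta) ord0 ord0))%R]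
     <= (expR (c * t ^+ 2 * frobenius eta ^+ 2))%R%:E)%E.
Hypothesis X_le : forall v : 'cV_p,
  frobenius (X *m v) <= Num.sqrt (n%:R * b) * frobenius v.
(** The Chernoff exponent per dimension: 4 comes from the tail bound and 16 from the squared radii
    [4 s] and [4 q] of the two nets. *)
Let kappa := K ^+ 2 / (64 * b * c).
Hypothesis kappa1 : 1 <= kappa.
Hypothesis kappa_delta : 64 * expR (- kappa) <= delta.

Let nR : 0 < n%:R :> R. Proof. by rewrite ltr0n. Qed.
Let delta0 : 0 < delta.
Proof. by apply: lt_le_trans kappa_delta; rewrite mulr_gt0// expR_gt0. Qed.
Let a0 : 0 <= a. Proof. exact: le_trans qa. Qed.
Let lnp0 : 0 <= ln p%:R :> R. Proof. by rewrite ln_ge0// ler1n. Qed.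

(** The left side is the [k]-th power of [64 exp (- kappa) <= delta <= 1]. *)
Let net_weight k : (0 < k)%N -> 64 ^+ k * expR (- (kappa * k%:R)) <= delta.
Proof.
move=> k0; rewrite -mulNr expRM_natr -exprMn.
have w0 : 0 <= 64 * expR (- kappa) by rewrite mulr_ge0// expR_ge0.
apply: (@le_trans _ _ (delta ^+ k)); first by rewrite lerXn2r// nnegrE// ltW.
by rewrite -[leRHS]expr1 ler_wiXn2l// ltW.
Qed.

Let first_rows_isometry (z : 'cV[R]_s) :
  frobenius (z^T *m first_rows sp 1%:M) = frobenius z.
Proof.
apply/eqP; rewrite -(eqrXn2 (n := 2))// ?frobenius_ge0//.
rewrite -!mxdotxx mxdot_mulr -mulmxA.
have -> : first_rows sp (1%:M : 'M[R]_p) *m (first_rows sp 1%:M)^T = 1%:M.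
  apply/matrixP => i j; rewrite mul_rowsub_mx mul1mx !mxE.
  by congr (_%:R); congr nat_of_bool; apply/eqP/eqP => [[/val_inj ->]|->].
by rewrite mulmx1 !mxdotxx frobenius_tr.
Qed.

(** Pad [z] with zeros to a vector of length [p], which preserves its norm, and apply the bound on
    [X]. *)
Lemma design_sub_le (z : 'cV[R]_s) :
  frobenius (z^T *m first_rows sp X^T) ^+ 2 <= n%:R * b * frobenius z ^+ 2.
Proof.
have -> : first_rows sp X^T = first_rows sp 1%:M *m X^T.
  by rewrite mul_rowsub_mx mul1mx.
rewrite mulmxA -frobenius_tr trmx_mul trmxK.
have := X_le (z^T *m first_rows sp 1%:M)^T.
rewrite frobenius_tr first_rows_isometry => h.
apply: (@le_trans _ _ ((Num.sqrt (n%:R * b) * frobenius z) ^+ 2)).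
  by rewrite lerXn2r// nnegrE ?mulr_ge0 ?frobenius_ge0.
by rewrite exprMn sqr_sqrtr// mulr_ge0// ltW.
Qed.

Lemma design_col_le (j : 'I_p) : frobenius (row j X^T) ^+ 2 <= n%:R * b.
Proof.
rewrite -frobenius_tr tr_row trmxK colE.
have d1 : frobenius (delta_mx j 0 : 'cV[R]_p) = 1.
  apply/eqP; rewrite -(eqrXn2 (n := 2))// ?frobenius_ge0// frobenius_sq expr1n.
  rewrite (bigD1 j)//= big_ord1 mxE !eqxx expr1n big1 ?addr0// => i ij.
  by rewrite big_ord1 mxE (negbTE ij) expr0n.
have := X_le (delta_mx j 0); rewrite d1 mulr1 => h.
apply: (@le_trans _ _ (Num.sqrt (n%:R * b) ^+ 2)).
  by rewrite lerXn2r// nnegrE ?frobenius_ge0.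
by rewrite sqr_sqrtr// mulr_ge0// ltW.
Qed.

Lemma measurable_bilinear_gt (u : 'rV_n) (v : 'cV_q) (t : R) :
  measurable [set w | t < (u *m E w *m v) ord0 ord0].
Proof.
rewrite -[X in measurable X]setTI.
rewrite (_ : [set w | _] = (fun w => (u *m E w *m v) ord0 ord0) @^-1` `]t, +oo[%classic).
  exact: measurable_bilinear.
by apply/seteqP; split => w /=; rewrite in_itv/= andbT.
Qed.

Let tS := K * Num.sqrt (n%:R * (s + q)%:R).
Let tR := K * Num.sqrt (n%:R * (q%:R * ln p%:R + a)).

Let bad_S (fg : lattice_index s * lattice_index q) : set T :=
  [set w | tS * (Num.sqrt s%:R * Num.sqrt q%:R) <
    ((lattice_point R fg.1)^T *m first_rows sp X^T *m E w *m lattice_point R fg.2) ord0 ord0].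

Let bad_R (jg : 'I_p * lattice_index q) : set T :=
  [set w | tR * Num.sqrt q%:R <
    (row jg.1 X^T *m E w *m lattice_point R jg.2) ord0 ord0].

Let prob_bad_S fg : in_net fg.1 -> in_net fg.2 ->
  (P (bad_S fg) <= (expR (- (kappa * (s + q)%:R)))%:E)%E.
Proof.
move=> net1 net2.
have sR : 0 < s%:R :> R by rewrite ltr0n.
have qR : 0 < q%:R :> R by rewrite ltr0n.
pose B : R := n%:R * b * (4 * s%:R) * (4 * q%:R).
have B0 : 0 < B by rewrite !mulr_gt0.
apply: (le_trans (bilinear_tail c0 mE indepE subgE B0 _ _)).
- by rewrite !mulr_ge0.
- apply: ler_pM; rewrite ?sqr_ge0//; last exact: sqr_frobenius_lattice_point.
  apply: (le_trans (design_sub_le _)); rewrite ler_wpM2l//.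
    by rewrite mulr_ge0// ltW.
  exact: sqr_frobenius_lattice_point.
rewrite lee_fin ler_expR lerN2 /tS !exprMn.
rewrite (@sqr_sqrtr _ (n%:R * _)) ?mulr_ge0// !(sqr_sqrtr (ler0n _ _)) /kappa /B.
by rewrite le_eqVlt; apply/orP; left; apply/eqP; field; rewrite !gt_eqF.
Qed.

Let prob_bad_R jg : in_net jg.2 ->
  (P (bad_R jg) <= (expR (- (4 * kappa * (q%:R * ln p%:R + a))))%:E)%E.
Proof.
move=> netg.
have qR : 0 < q%:R :> R by rewrite ltr0n.
pose B : R := n%:R * b * (4 * q%:R).
have B0 : 0 < B by rewrite !mulr_gt0.
have qlnpa : 0 <= q%:R * ln p%:R + a by rewrite addr_ge0// mulr_ge0.
apply: (le_trans (bilinear_tail c0 mE indepE subgE B0 _ _)).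
- by rewrite !mulr_ge0.
- apply: ler_pM; rewrite ?sqr_ge0//; last exact: sqr_frobenius_lattice_point.
  exact: design_col_le.
rewrite lee_fin ler_expR lerN2 /tR !exprMn.
rewrite (@sqr_sqrtr _ (n%:R * _)) ?mulr_ge0// !(sqr_sqrtr (ler0n _ _)) /kappa /B.
by rewrite le_eqVlt; apply/orP; left; apply/eqP; field; rewrite !gt_eqF.
Qed.

(** The bad set is the finite union of violations at net points, hence measurable; outside it the
    net bounds extend to all vectors. Each of the two families costs at most [delta]. *)
Lemma noise_event : exists2 bad : set T,
  measurable bad /\ (P bad <= (2 * delta)%:E)%E &
  forall w, ~ bad w ->
    (forall (u : 'cV_s) (v : 'cV_q),
       (u^T *m first_rows sp (X^T *m E w) *m v) ord0 ord0
         <= tS * (frobenius u * frobenius v)) /\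
    (forall (j : 'I_p) (v : 'cV_q),
       (row j (X^T *m E w) *m v) ord0 ord0 <= tR * frobenius v).
Proof.
have [mS PS] := @measure_exists_le _ T R P _
  [pred fg : lattice_index s * lattice_index q | in_net fg.1 && in_net fg.2] bad_S _
  (fun fg => measurable_bilinear_gt _ _ _)
  (fun fg net => prob_bad_S (proj1 (andP net)) (proj2 (andP net))).
have [mR PR] := @measure_exists_le _ T R P _
  [pred jg : 'I_p * lattice_index q | in_net jg.2] bad_R _
  (fun fg => measurable_bilinear_gt _ _ _) (fun jg net => prob_bad_R net).
eexists; first split; first exact: (measurableU _ _ mS mR).
  apply: (le_trans (measureU2 _ mS mR)).
  rewrite mulr_natl mulr2n EFinD leeD//.
    apply: (le_trans PS); rewrite lee_fin.
    have -> : #|[pred fg : lattice_index s * lattice_index q | in_net fg.1 && in_net fg.2]|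
        = (#|@in_net s| * #|@in_net q|)%N by rewrite -cardX.
    apply: le_trans (net_weight (k := s + q) _); last by rewrite addn_gt0 s0.
    by rewrite ler_wpM2r ?expR_ge0// natrM exprD ler_pM// card_in_net.
  apply: (le_trans PR); rewrite lee_fin.
  have -> : #|[pred jg : 'I_p * lattice_index q | in_net jg.2]| = (p * #|@in_net q|)%N.
    by rewrite -[p in RHS]card_ord -cardX.
  apply: le_trans (net_weight q0).
  have pR : 0 < p%:R :> R by rewrite ltr0n.
  (* The term [q log p] in the exponent cancels the union over [p] rows, and [a >= q] pays for the
     net of size [64^q]. *)
  apply: (@le_trans _ _ (p%:R * 64 ^+ q * (p%:R^-1 * expR (- (kappa * q%:R))))).
    rewrite natrM ler_pM ?mulr_ge0 ?expR_ge0//.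
      by rewrite ler_wpM2l// card_in_net.
    rewrite -[p%:R^-1]lnK ?posrE ?invr_gt0// lnV ?posrE// -expRD ler_expR.
    have q1 : 1 <= q%:R :> R by rewrite ler1n.
    have lnp_le : ln p%:R <= kappa * (q%:R * ln p%:R).
      by rewrite mulrA ler_peMl// mulr_ege1.
    have q_le : kappa * q%:R <= kappa * a by rewrite ler_wpM2l// (le_trans _ kappa1).
    have a_ge : 0 <= kappa * a by rewrite mulr_ge0// (le_trans _ kappa1).
    rewrite (_ : 4 * kappa * _ =
      4 * (kappa * (q%:R * ln p%:R)) + 4 * (kappa * a)); last by ring.
    move: lnp0 lnp_le q_le a_ge.
    move: (ln _) (kappa * (_ * _)) (kappa * a) (kappa * q%:R) => x1 x2 x3 x4; lra.
  rewrite mulrACA divff ?gt_eqF// mul1r//.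
move=> w /not_orP[nS nR']; split => [u v|j v].
  apply: bilinear_net_bound => f g netf netg.
  rewrite leNgt; apply/negP => h; apply: nS; exists (f, g); first by rewrite /= netf.
  by rewrite /bad_S/= -[X in X *m _]mulmxA -first_rows_mul.
apply: net_bound => g netg.
rewrite leNgt; apply/negP => h; apply: nR'; exists (j, g) => //.
by rewrite /bad_R/= -row_mul.
Qed.
End noise_event.

(** * Measurability of the events in the conclusions *)

Section random_matrix_events.
Context d (T : measurableType d) (R : realType) (P : probability T R).

Lemma measurable_frobenius m n (A : T -> 'M[R]_(m, n)) :
  random_matrix A -> measurable_fun [set: T] (fun w => frobenius (A w)).
Proof.
move=> mA; apply: (measurableT_comp (continuous_measurable_fun (@sqrt_continuous R))).
apply: measurable_sum => i; apply: measurable_sum => j.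
exact: measurable_funX.
Qed.

Lemma random_matrix_mulmx m n k (X : 'M[R]_(m, n)) (A : T -> 'M[R]_(n, k)) :
  random_matrix A -> random_matrix (fun w => X *m A w).
Proof.
move=> mA i j; under eq_fun do rewrite mxE.
by apply: measurable_sum => l; apply: measurable_funM => //; exact: mA.
Qed.

Lemma random_matrixB m n (A : T -> 'M[R]_(m, n)) (B : 'M[R]_(m, n)) :
  random_matrix A -> random_matrix (fun w => A w - B).
Proof.
move=> mA i j; under eq_fun do rewrite !mxE.
by apply: measurable_funD => //; exact: mA.
Qed.

Lemma measurable_frobenius_gt m n (A : T -> 'M[R]_(m, n)) (t : R) :
  random_matrix A -> measurable [set w | t < `|frobenius (A w)|].
Proof.
move=> mA; rewrite -[X in measurable X]setTI.
rewrite (_ : [set w | _] = (fun w => frobenius (A w)) @^-1` `]t, +oo[%classic).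
  exact: measurable_frobenius.
by apply/seteqP; split => w /=; rewrite in_itv/= andbT ger0_norm// frobenius_ge0.
Qed.

Lemma measurable_rows_eq0 p q s (A : T -> 'M[R]_(p, q)) : random_matrix A ->
  measurable [set w | forall j : 'I_p, (s <= j)%N -> row j (A w) = 0].
Proof.
move=> mA.
rewrite (_ : [set w | _] = \bigcap_(jk in [set jk : 'I_p * 'I_q | (s <= jk.1)%N])
    ((fun w => A w jk.1 jk.2) @^-1` [set 0])).
  apply: fin_bigcap_measurable => [|[j k] _]; first exact: finite_finset.
  by rewrite -[X in measurable X]setTI; apply: mA.
apply/seteqP; split => w /= Aw.
  by move=> [j k] /= sj; have /rowP/(_ k) := Aw j sj; rewrite !mxE.
by move=> j sj; apply/rowP => k; rewrite !mxE; apply: (Aw (j, k)).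
Qed.

End random_matrix_events.

(** * Extreme penalty levels as bounds on the individual penalties *)

Section penalty_bounds.
Variables (R : realType) (p s : nat) (lam : 'I_p -> R).
Hypothesis lam0 : forall j, 0 <= lam j.

Lemma le_lambda1 (j : 'I_p) : (j < s)%N -> lam j <= lambda1 s lam.
Proof.
move=> js; apply: ub_le_sup; last by exists j.
exists (\sum_k lam k) => _ [k _ <-].
by rewrite (bigD1 k)//= lerDl sumr_ge0.
Qed.

Lemma ge_lambda2 (j : 'I_p) : (s <= j)%N -> lambda2 s lam <= lam j.
Proof.
move=> sj; apply: ge_inf; last by exists j.
by exists 0 => _ [k _ <-].
Qed.

Lemma lambda2_ge0 : (s < p)%N -> 0 <= lambda2 s lam.
Proof.
move=> sp; apply: lb_le_inf.
  by exists (lam (Ordinal sp)), (Ordinal sp) => //=.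
by move=> _ [k _ <-].
Qed.
End penalty_bounds.

(* The constant [K] solves [K^2 / (64 b c) = kappa]. *)
Lemma noise_level_exists (R : realType) (b c delta : R) :
  0 < b -> 0 < c -> 0 < delta ->
  exists2 K : R, 0 <= K &
    1 <= K ^+ 2 / (64 * b * c) /\ 64 * expR (- (K ^+ 2 / (64 * b * c))) <= delta.
Proof.
move=> b0 c0 delta0.
(* The entry 1 gives the first bound, the logarithm gives [64 exp (- kappa) <= delta]. *)
pose kappa := Num.max 1 (ln (64 / delta)).
have kappa0 : 0 <= kappa by rewrite /kappa le_max ler01.
exists (Num.sqrt (64 * b * c * kappa)); first exact: sqrtr_ge0.
have bc0 : 0 < 64 * b * c by rewrite !mulr_gt0.
rewrite sqr_sqrtr ?mulr_ge0 ?(ltW b0) ?(ltW c0)//.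
rewrite mulrAC divff ?gt_eqF// mul1r; split; first by rewrite /kappa le_max lexx.
have d0 : 0 < 64 / delta by rewrite divr_gt0.
apply: (@le_trans _ _ (64 * expR (- ln (64 / delta)))).
  by rewrite ler_wpM2l// ler_expR lerN2 /kappa le_max lexx orbT.
rewrite expRN lnK ?posrE// invf_div mulrCA divff ?mulr1//.
Qed.

(** * From fixed sample size to the asymptotic conclusions *)

Unset Implicit Arguments.

Theorem theorem1 (R : realType)
  (d : nat -> measure_display) (T : forall n, measurableType (d n))
  (P : forall n, probability (T n) R)
  (p q s r : nat -> nat)
  (X : forall n, 'M[R]_(n, p n)) (C0 : forall n, 'M[R]_(p n, q n))
  (E : forall n, T n -> 'M[R]_(n, q n)) (Y : forall n, T n -> 'M[R]_(n, q n))
  (lam : forall n, 'I_(p n) -> R)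
  (Chat : forall n, T n -> 'M[R]_(p n, q n))
  (model : forall n, (0 < n)%N -> forall w : T n,
     Y n w = X n *m C0 n + E n w)
  (r_bounds : forall n, (0 < n)%N -> (1 <= r n <= minn (p n) (q n))%N)
  (s_bounds : forall n, (0 < n)%N -> (1 <= s n < p n)%N)
  (rank_C0 : forall n, (0 < n)%N -> (\rank (C0 n) <= r n)%N)
  (rows_C0 : forall n, (0 < n)%N -> forall j : 'I_(p n),
     (row j (C0 n) != 0) = (j < s n)%N)
  (A1 : exists2 c : R, 0 < c & forall n, (0 < n)%N ->
     restricted_eigenvalue (q n) (s n) (sample_cov (X n)) c)
  (A2 : exists b : R, forall n, (0 < n)%N -> forall a : R,
     eigenvalue (sample_cov (X n)) a -> a <= b)
  (E_measurable : forall n, (0 < n)%N -> random_matrix (E n))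
  (A3_independent : forall n, (0 < n)%N ->
     independent_vectors (P n) (fun i w => row i (E n w)))
  (A3_identical : forall n, (0 < n)%N ->
     identically_distributed (P n) (fun i w => row i (E n w)))
  (A3_mean : forall n, (0 < n)%N -> forall i j,
     ('E_(P n)[fun w => E n w i j] = 0)%E)
  (A3_subgaussian : exists2 c : R, 0 < c & forall n, (0 < n)%N ->
     forall (i : 'I_n) (t : R) (eta : 'cV[R]_(q n)),
     ('E_(P n)[fun w => (expR (t * (row i (E n w) *m eta) ord0 ord0))%R]
        <= (expR (c * t ^+ 2 * frobenius eta ^+ 2))%R%:E)%E)
  (lam_ge0 : forall n, (0 < n)%N -> forall j, 0 <= lam n j)
  (A4_lambda1 : (fun n => lambda1 (s n) (lam n)) =O_\oo
     (fun n => Num.sqrt (srrr_rate R (q n) (s n) (r n) / (n%:R * (s n)%:R))))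
  (A4_lambda2 : (fun n => Num.sqrt (((q n)%:R * ln (p n)%:R
                                      + srrr_rate R (q n) (s n) (r n)) / n%:R))
     =o_\oo (fun n => lambda2 (s n) (lam n)))
  (Chat_measurable : forall n, (0 < n)%N -> random_matrix (Chat n))
  (Chat_solution : forall n, (0 < n)%N -> forall w : T n,
     is_srrr_solution (r n) (Y n w) (X n) (lam n) (Chat n w)) :
  [/\ bigO_prob P (fun n w => frobenius (X n *m Chat n w - X n *m C0 n))
        (fun n => Num.sqrt (srrr_rate R (q n) (s n) (r n))),
      (fun n => P n [set w | forall j : 'I_(p n), (s n <= j)%N ->
                               row j (Chat n w) = 0]) @ \oo --> 1%E
    & bigO_prob P (fun n w => frobenius (Chat n w - C0 n))
        (fun n => Num.sqrt (srrr_rate R (q n) (s n) (r n) / n%:R))].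
Proof.
case: A1 => c1 c10 RE; case: A2 => b1 Xb1; case: A3_subgaussian => c2 c20 subg.
(* The noise constants divide by [b], so the eigenvalue bound is made positive. *)
pose b := Num.max b1 1.
have b0 : 0 < b by rewrite /b lt_max ltr01 orbT.
have Xb n : (0 < n)%N -> forall a, eigenvalue (sample_cov (X n)) a -> a <= b.
  by move=> n0 a /(Xb1 n n0) ab; rewrite /b le_max ab.
move/eqO_exP: A4_lambda1 => [L L0 lam1_near].
move/eqoP: A4_lambda2 => lam2_near.
pose rate n : R := srrr_rate R (q n) (s n) (r n).
(* One event serves all three conclusions, with constants depending on [delta] but not on [n]. *)
have good_event (delta : R) : 0 < delta -> exists K1 K3 : R, \forall n \near \oo,
    (0 < n)%N /\
    exists2 bad : set (T n), measurable bad /\ (P n bad <= delta%:E)%E &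
      forall w, ~ bad w ->
        [/\ frobenius (X n *m Chat n w - X n *m C0 n) <= K1 * Num.sqrt (rate n),
            forall j : 'I_(p n), (s n <= j)%N -> row j (Chat n w) = 0
          & frobenius (Chat n w - C0 n) <= K3 * Num.sqrt (rate n / n%:R)].
  (* The noise event fails with probability at most [2 delta'], and its net count requires
     [delta' <= 1]. *)
  move=> delta0; pose delta' := Num.min (delta / 2) 1.
  have delta'0 : 0 < delta' by rewrite /delta' lt_min ltr01 divr_gt0.
  have [K K0 [kappa1 kappa_delta]] := noise_level_exists b0 c20 delta'0.
  pose W := 4 * K + L.
  have W0 : 0 <= W by rewrite addr_ge0 ?mulr_ge0 ?(ltW L0).
  pose B := 2 * K + W + 1 + 2 * b * (W / c1).
  have B0 : 0 < B.
    have : 0 <= 2 * b * (W / c1) by rewrite !mulr_ge0 ?invr_ge0 ?(ltW b0) ?(ltW c10).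
    by rewrite /B; lra.
  (* The little-o assumption is used at [1 / B]: eventually [lambda2] is at least [B] times the
     noise scale. *)
  have Binv0 : 0 < B^-1 by rewrite invr_gt0.
  exists (Num.sqrt (W * (W / c1))), (2 * (W / c1)).
  have := lam2_near _ Binv0; move: lam1_near.
  apply: filter_app2; near=> n => lam1_le lam2_ge.
  have n0 : (0 < n)%N by near: n; exists 1%N.
  split => //.
  have /andP[r0] := r_bounds n n0; rewrite leq_min => /andP[rp rq].
  have /andP[s0 sp] := s_bounds n n0.
  have p0 : (0 < p n)%N by exact: leq_trans rp.
  have q0 : (0 < q n)%N by exact: leq_trans rq.
  have rpq : (0 < r n <= q n)%N by rewrite r0.
  have q_rate : (q n)%:R <= rate n.
    by rewrite /rate srrr_rateE// ler_nat response_dim_le_rate.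
  have X_le (v : 'cV[R]_(p n)) : frobenius (X n *m v) <= Num.sqrt (n%:R * b) * frobenius v.
    exact: (frobenius_design_le n0 (ltW b0) (Xb n n0)).
  have delta'1 : delta' <= 1 by rewrite /delta' ge_min lexx orbT.
  have [bad [mbad Pbad] good] := noise_event n0 p0 q0 s0 (ltnW sp) c20 b0 K0 q_rate
    delta'1 (E_measurable n n0) (A3_independent n n0) (subg n n0) X_le kappa1 kappa_delta.
  exists bad.
    split => //; apply: (le_trans Pbad); rewrite lee_fin mulrC -ler_pdivlMr//.
    by rewrite /delta' ge_min lexx.
  move=> w /good[noise_S noise_R].
  have sol : is_srrr_solution (r n) (X n *m C0 n + E n w) (X n) (lam n) (Chat n w).
    by rewrite -model//; exact: Chat_solution.
  have C0_0 (j : 'I_(p n)) : (s n <= j)%N -> row j (C0 n) = 0.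
    by move=> sj; apply/eqP; rewrite -[_ == _]negbK rows_C0// -leqNgt.
  have lam1 (j : 'I_(p n)) : (j < s n)%N ->
      lam n j <= L * Num.sqrt (srrr_rate R (q n) (s n) (r n) / (n%:R * (s n)%:R)).
    move=> js; apply: (le_trans (le_lambda1 (lam_ge0 n n0) js)).
    by apply: (le_trans (ler_norm _)); rewrite -[leRHS]ger0_norm ?mulr_ge0 ?(ltW L0)// normrM (gtr0_norm L0).
  have lam2 (j : 'I_(p n)) : (s n <= j)%N -> B * Num.sqrt
      (((q n)%:R * ln (p n)%:R + srrr_rate R (q n) (s n) (r n)) / n%:R) <= lam n j.
    move=> sj; apply: le_trans (ge_lambda2 (lam_ge0 n n0) sj).
    move: lam2_ge; rewrite ger0_norm ?sqrtr_ge0// (ger0_norm (lambda2_ge0 (lam_ge0 n n0) sp)).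
    by rewrite ler_pdivlMl.
  have noise_rows (j : 'I_(p n)) (v : 'cV_(q n)) (_ : (s n <= j)%N) := noise_R j v.
  have B_large : 2 * K + W + 1 + 2 * b * (W / c1) <= B by [].
  have L0' := ltW L0; have b0' := ltW b0.
  rewrite -mulmxBr; split.
  - exact: (prediction_error n0 rpq s0 p0 sol (rank_C0 n n0) C0_0
      (lam_ge0 n n0) c10 b0' K0 L0' (RE n n0) lam1 lam2 B_large noise_S noise_rows).
  - move=> j; exact: (irrelevant_rows_eq0 n0 rpq s0 p0 sol (rank_C0 n n0) C0_0
      (lam_ge0 n n0) c10 b0' K0 L0' (RE n n0) (Xb n n0) lam1 lam2 B_large noise_S noise_rows).
  - exact: (coefficient_error n0 rpq s0 p0 sol (rank_C0 n n0) C0_0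
      (lam_ge0 n n0) c10 b0' K0 L0' (RE n n0) lam1 lam2 B_large noise_S noise_rows).
split.
- move=> delta /good_event[K1 [K3 near_good]]; exists K1.
  apply: filterS near_good => n [n0 [bad [mbad Pbad] good]].
  apply: le_trans Pbad; apply: le_measure; [apply/mem_set|exact/mem_set|].
    apply: measurable_frobenius_gt; apply: random_matrixB.
    exact/random_matrix_mulmx/Chat_measurable.
  move=> w /=; apply: contraPP => /good[h _ _]; apply/negP.
  by rewrite -leNgt ger0_norm ?frobenius_ge0.
(* The estimator is assumed measurable for [n >= 1], hence eventually. *)
- have near_measurable : \forall n \near \oo, measurable [set w |
      forall j : 'I_(p n), (s n <= j)%N -> row j (Chat n w) = 0].
    by exists 1%N => // n n0; exact/measurable_rows_eq0/Chat_measurable.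
  apply/fine_cvgP; split.
    by apply: filterS near_measurable => n mA; exact: fin_num_measure.
  apply/cvgrPdist_le => /= delta /good_event[K1 [K3 near_good]].
  apply: filterS near_good => n [n0 [bad [mbad Pbad] good]].
  set A := [set w | _].
  have mA : measurable A by exact/measurable_rows_eq0/Chat_measurable.
  (* The distance from [P A] to 1 is the probability of the complement, which lies inside [bad]. *)
  have AC : (P n (~` A) <= delta%:E)%E.
    apply: le_trans Pbad; apply: le_measure; [exact/mem_set/measurableC|exact/mem_set|].
    by move=> w; apply: contra_notP => /good[].
  have PA : P n A = (fine (P n A))%:E by rewrite fineK// fin_num_measure.
  have fA1 : fine (P n A) <= 1 by rewrite -lee_fin -PA probability_le1.
  move: AC; rewrite probability_setC// PA -EFinB lee_fin => h.
  by rewrite ger0_norm ?subr_ge0.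
- move=> delta /good_event[K1 [K3 near_good]]; exists K3.
  apply: filterS near_good => n [n0 [bad [mbad Pbad] good]].
  apply: le_trans Pbad; apply: le_measure; [apply/mem_set|exact/mem_set|].
    by apply: measurable_frobenius_gt; apply/random_matrixB/Chat_measurable.
  move=> w /=; apply: contraPP => /good[_ _ h]; apply/negP.
  by rewrite -leNgt ger0_norm ?frobenius_ge0.
Unshelve. all: by end_near.
Qed.
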